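(* Let $d\ge 2$ and let $\mathcal{H}=\mathbb{C}^d\otimes\mathbb{C}^d$. The maximum value of the disentangling power $\delta(U)$ over all unitary operators $U$ on $\mathcal{H}$ is achieved for the unitaries with maximum entangling power $\epsilon(U)$. For $d\neq 2,6$ this maximum value is given by $$\delta(U)=\frac{1}{d-1},$$ and can be attained by permutation matrices only.
   Context: Fix an orthonormal basis $|1\rangle,\dots,|d\rangle$ of $\mathbb{C}^d$ and write $|ij\rangle=|i\rangle\otimes|j\rangle$. A permutation matrix is a unitary on $\mathcal{H}=\mathbb{C}^d\otimes\mathbb{C}^d$ that permutes the product basis vectors $|ij\rangle$, $1\le i,j\le d$. Normalized linear entropy: for a unit vector $|\psi\rangle\in\mathcal{H}$, $$S_L(|\psi\rangle):=\frac{d}{d-1}\bigl(1-\operatorname{Tr}\rho^2\bigr),\qquad \rho=\operatorname{Tr}_B|\psi\rangle\langle\psi|,$$ where $\operatorname{Tr}_B$ is the partial trace over the second tensor factor. Entangling power: for a unitary $U$ on $\mathcal{H}$, $$\epsilon(U):=\int_{\langle\psi_1|\psi_1\rangle=1}\int_{\langle\psi_2|\psi_2\rangle=1}S_L\bigl(U|\psi_1\rangle|\psi_2\rangle\bigr)\,d\psi_1\,d\psi_2,$$ where $d\psi_1,d\psi_2$ are the normalized uniform (unitarily invariant) probability measures on the unit sphere of $\mathbb{C}^d$ and $|\psi_1\rangle|\psi_2\rangle=|\psi_1\rangle\otimes|\psi_2\rangle$. Disentangling power: for a unitary $U$ on $\mathcal{H}$, $$\delta(U):=1-\int_{U(d)}\int_{U(d)}S_L\bigl(U(V\otimes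 W)|\psi_+\rangle\bigr)\,dV\,dW,\qquad |\psi_+\rangle=\frac{1}{\sqrt d}\sum_{i=1}^d|ii\rangle,$$ where $dV,dW$ are the normalized Haar measures on the unitary group $U(d)$. *)

(* Defs.v *)
(* MathComp / MathComp-Analysis *)
From HB Require Import structures.
From mathcomp Require Import all_boot all_order all_algebra spectral.
From mathcomp Require Import complex mxtens.
From mathcomp Require Import all_classical all_reals all_analysis.

Set Implicit Arguments.
Unset Strict Implicit.
Unset Printing Implicit Defensive.

Import Order.TTheory GRing.Theory Num.Theory numFieldNormedType.Exports.
Local Open Scope classical_set_scope.
Local Open Scope ring_scope.
Local Open Scope sesquilinear_scope.
Local Open Scope complex_scope.

(* C^d is 'cV[R[i]]_d, and C^d (x) C^d is 'cV[R[i]]_(d * d), the coordinate of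
   |ij> being the one of index mxtens_index (i, j); tensmx is the Kronecker
   product in this ordering. *)

Section Bipartite.
Variables (R : realType) (d : nat).

Definition ket_bra n (psi : 'cV[R[i]]_n) : 'M[R[i]]_n := psi *m psi^t*.

(* Tr_B : partial trace over the second tensor factor. *)
Definition partial_traceB (X : 'M[R[i]]_(d * d)) : 'M[R[i]]_d :=
  \matrix_(i, i') \sum_(j < d) X (mxtens_index (i, j)) (mxtens_index (i', j)).

(* Tr rho^2 is real since rho is Hermitian; complex.Re only casts it to R. *)
Definition linear_entropy (psi : 'cV[R[i]]_(d * d)) : R :=
  let rho := partial_traceB (ket_bra psi) in
  d%:R / (d%:R - 1) * (1 - complex.Re (\tr (rho *m rho))).

Definition basis_ket (i j : 'I_d) : 'cV[R[i]]_(d * d) :=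
  delta_mx (mxtens_index (i, j)) 0.

Definition psi_plus : 'cV[R[i]]_(d * d) :=
  ((Num.sqrt d%:R)^-1)%:C *: \sum_(i < d) basis_ket i i.

End Bipartite.

(* Borel sigma-algebra of the space of complex m x n matrices; the regular
   module R[i]^o carries the usual topology of the complex field. *)
Definition borel_mx (R : realType) (m n : nat) :=
  g_sigma_algebraType (@open 'M[R[i]^o]_(m, n)).

Definition unit_sphere (R : realType) (n : nat) : set 'cV[R[i]]_n :=
  [set psi | (psi^t* *m psi) 0 0 = 1].

Definition unitary_group (R : realType) (n : nat) : set 'M[R[i]]_n :=
  [set U | U \is unitarymx].

(* The measures on the sphere and on U(n) are represented as Borel
   probabilities on the ambient matrix space that are carried by these closed
   subsets; each predicate below determines the measure uniquely. *)
Definition is_uniform_sphere (R : realType) (n : nat)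
    (mu : probability (borel_mx R n 1) R) : Prop :=
  mu (@unit_sphere R n) = 1%E /\
  forall (V : 'M[R[i]]_n) (A : set (borel_mx R n 1)),
    V \is unitarymx -> measurable A ->
    mu [set psi : 'cV[R[i]]_n | A (V *m psi)] = mu A.

Definition is_haar_unitary (R : realType) (n : nat)
    (nu : probability (borel_mx R n n) R) : Prop :=
  nu (@unitary_group R n) = 1%E /\
  forall (V : 'M[R[i]]_n) (A : set (borel_mx R n n)),
    V \is unitarymx -> measurable A ->
    nu [set W : 'M[R[i]]_n | A (V *m W)] = nu A.

Definition entangling_power (R : realType) (d : nat)
    (mu : probability (borel_mx R d 1) R) (U : 'M[R[i]]_(d * d)) : R :=
  \int[mu]_(psi1 in @unit_sphere R d)
    \int[mu]_(psi2 in @unit_sphere R d)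
      linear_entropy (U *m tensmx (psi1 : 'cV[R[i]]_d) (psi2 : 'cV[R[i]]_d)).

Definition disentangling_power (R : realType) (d : nat)
    (nu : probability (borel_mx R d d) R) (U : 'M[R[i]]_(d * d)) : R :=
  1 - \int[nu]_(V in @unitary_group R d)
        \int[nu]_(W in @unitary_group R d)
          linear_entropy
            (U *m tensmx (V : 'M[R[i]]_d) (W : 'M[R[i]]_d) *m psi_plus R d).

Definition maximizes (T : Type) (R : realType) (D : set T) (f : T -> R)
    (x : T) : Prop :=
  D x /\ forall y, D y -> f y <= f x.

(* Main.v *)
Require Import Defs.
From HB Require Import structures.
From mathcomp Require Import all_boot all_order all_algebra spectral.
From mathcomp Require Import complex mxtens perm.
From mathcomp Require Import all_classical all_reals all_analysis.
From mathcomp Require Import measurable_realfun.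
From mathcomp Require Import ring lra zify.
Import Order.TTheory GRing.Theory Num.Theory numFieldNormedType.Exports.
Local Open Scope complex_scope.
Local Open Scope ring_scope.
Local Open Scope sesquilinear_scope.

(* Both powers average the purity of U phi, where phi has the coordinates
   k sum_i X_(m i) Y_(l i) for independent random isometries X, Y of size
   d x n with k^2 n = 1: n = 1 gives product states and n = d gives the states
   (V (x) W)|psi_+>.  The fourth moments of a left-invariant random isometry
   are combinations of the two ways of matching indices, so the average purity
   is an affine function of G(U) = |N|^2 + |N'|^2, where N and N' are the Gram
   matrices of the realignment and of the partial transpose of U.  Its slope is
   positive for n = 1 and negative for n = d; hence both powers are decreasing
   in G and have the same maximizers, which exist by compactness.

   As N and N' have trace d^2, G >= 2 d^2, with equality when N and N' are the
   identity.  For permutation matrices this means a pair of orthogonal Latin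
   squares of order d; these exist for d <> 2, 6 by the theorem of Bose,
   Shrikhande and Parker, obtained here from Wilson's construction
   3 t + u (t coprime to 6) and explicit arrays of orders 4, 8, 10 and 14. *)

(** * Orthogonal arrays *)

(** Strength 2 and index 1: any two columns are jointly injective on the rows, and since there are
    [#|T| ^ 2] rows, every pair of symbols then occurs exactly once. With four columns this encodes
    a pair of orthogonal Latin squares. *)
Definition orthogonal_array (k : nat) (T B : finType) (c : 'I_k -> B -> T) :=
  #|B| = (#|T| ^ 2)%N /\
  forall i j b b', i != j -> c i b = c i b' -> c j b = c j b' -> b = b'.

Definition has_oa (k n : nat) :=
  exists (B : finType) (c : 'I_k -> B -> 'I_n), orthogonal_array k 'I_n B c.

Lemma has_oaW (k n : nat) (T B : finType) (c : 'I_k -> B -> T) :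
  #|T| = n -> orthogonal_array k T B c -> has_oa k n.
Proof.
move=> <- [cB cP]; exists B, (fun i b => enum_rank (c i b)).
split=> [|i j b b' ij /enum_rank_inj e1 /enum_rank_inj e2].
  by rewrite card_ord cB.
exact: cP ij e1 e2.
Qed.

Lemma has_oa_prod (k m n : nat) : has_oa k m -> has_oa k n -> has_oa k (m * n).
Proof.
move=> [B [c [cB cP]]] [B' [c' [cB' cP']]].
apply: (has_oaW k _ _ _ (fun i (b : B * B') => (c i b.1, c' i b.2))).
  by rewrite card_prod !card_ord.
split=> [|i j [b1 b2] [b1' b2'] ij /= [e1 e2] [f1 f2]].
  by rewrite !card_prod cB cB' !card_ord expnMn.
by rewrite (cP _ _ _ _ ij e1 f1) (cP' _ _ _ _ ij e2 f2).
Qed.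

Lemma has_oa1 (k : nat) : has_oa k 1.
Proof.
exists unit, (fun _ _ => ord0); split; first by rewrite card_unit card_ord.
by move=> i j [] [].
Qed.

Lemma affine_sub {A : comPzRingType} {i j : nat} {x x' y y' : A} : (i <= j)%N ->
  x + i%:R * y = x' + i%:R * y' -> x + j%:R * y = x' + j%:R * y' ->
  (j - i)%:R * y = (j - i)%:R * y'.
Proof.
move=> ij e1 e2; rewrite natrB //.
have -> : (j%:R - i%:R) * y = (x + j%:R * y) - (x + i%:R * y) by ring.
by rewrite e1 e2; ring.
Qed.

(** Rows are the points (x, y) of the plane over Z/n; column i is the slope [x + i y] and the last
    column is y itself. Two slopes i < j recover y because j - i is a unit modulo n. *)
Lemma has_oa_linear (k n : nat) :
  (1 < n)%N -> (forall j, (0 < j < k)%N -> coprime n j) -> has_oa k.+1 n.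
Proof.
move=> n1 cop.
pose c (i : 'I_k.+1) (p : 'Z_n * 'Z_n) :=
  if i == k :> nat then p.2 else p.1 + (i : nat)%:R * p.2.
have cardZ : #|'Z_n| = n by rewrite card_ord Zp_cast.
apply: (has_oaW _ _ _ _ c) => //; split; first by rewrite card_prod cardZ.
suff H (i j : 'I_k.+1) b b' :
    (i < j)%N -> c i b = c i b' -> c j b = c j b' -> b = b'.
  move=> i j b b'; rewrite neq_ltn => /orP[] ij e1 e2.
    exact: H ij e1 e2.
  exact: H ij e2 e1.
case: b b' => [x y] [x' y'] ij; rewrite /c /=.
have ik : (i < k)%N by rewrite (leq_trans ij) // -ltnS ltn_ord.
rewrite (ltn_eqF ik); case: eqP => [_ e1 e2|/eqP jk e1 e2].
  by move: e1; rewrite e2 => /addIr ->.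
have ed := affine_sub (ltnW ij) e1 e2.
have u : ((j - i)%:R : 'Z_n) \is a GRing.unit.
  rewrite unitZpE // cop // subn_gt0 ij /=.
  by rewrite (leq_ltn_trans (leq_subr _ _)) // ltn_neqAle jk -ltnS ltn_ord.
have ey := mulrI u ed.
by move: e1; rewrite ey => /addIr ->.
Qed.

(** Relabelling the symbols of each column separately preserves the array, so an arbitrary row can
    be made constant. In Wilson's construction the last symbol plays the new point, and this row is
    the one left out. *)
Lemma has_oa_row (k m : nat) : has_oa k m.+1 ->
  exists (B : finType) (c : 'I_k -> B -> 'I_m.+1) (b0 : B),
    orthogonal_array k 'I_m.+1 B c /\ forall i, c i b0 = ord_max.
Proof.
move=> [B [c [cB cP]]].
have /card_gt0P[b0 _] : (0 < #|B|)%N by rewrite cB card_ord expn_gt0.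
exists B, (fun i b => tperm (c i b0) ord_max (c i b)), b0.
split=> [|i]; last by rewrite tpermL.
by split=> // i j b b' ij /perm_inj e1 /perm_inj e2; exact: cP ij e1 e2.
Qed.

(* Wilson's construction: the last group of a transversal design of order t is
   truncated to u points; the points outside it are multiplied by m, and each
   remaining point of the truncated group becomes one new point in every
   group. *)
Lemma has_oa_wilson (k m t u : nat) : (0 < k)%N -> (u <= t)%N ->
  has_oa k m -> has_oa k m.+1 -> has_oa k.+1 t -> has_oa k u ->
  has_oa k (m * t + u).
Proof.
move=> k0 ut [Bm [e [eB eP]]] /has_oa_row[Bm1 [f [f0 [[fB fP] f0P]]]].
move=> [Bt [l [lB lP]]] [Bu [g [gB gP]]].
(* [z b] is the point of the truncated group on the block b; it survives when it is below u. *)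
pose z b := l ord_max b.
(* The three kinds of rows: a block without surviving point carries the array of order m, a block
   through one carries the array of order m + 1 without its constant row, and the new points carry
   the array of order u. *)
pose B : finType := ({b : Bt | ~~ (z b < u)%N} * Bm +
  ({b : Bt | (z b < u)%N} * {r : Bm1 | r != f0} + Bu))%type.
pose T : finType := ('I_t * 'I_m + 'I_u)%type.
pose c (i : 'I_k) (b : B) : T := match b with
  | inl (b, r) => inl (l (lift ord_max i) (sval b), e i r)
  | inr (inl (b, r)) => match unlift ord_max (f i (sval r)) with
      | Some s => inl (l (lift ord_max i) (sval b), s)
      | None => inr (Ordinal (valP b))
      end
  | inr (inr r) => inr (g i r)
  end.
have liftM (i j : 'I_k) : i != j -> lift ord_max i != lift ord_max j :> 'I_k.+1.
  by move=> ij; apply: contra ij => /eqP /lift_inj ->.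
have fmax (i : 'I_k) r : (unlift ord_max (f i r) = None) -> f i r = f i f0.
  by case: unliftP => // ->; rewrite f0P.
have fS (i : 'I_k) r r' s : unlift ord_max (f i r) = Some s ->
    unlift ord_max (f i r') = Some s -> f i r = f i r'.
  by case: unliftP => // ? -> [->]; case: unliftP => // ? -> [->].
apply: (has_oaW _ _ T B c); first by rewrite card_sum card_prod !card_ord mulnC.
(* The last column and any other one determine the block, so t blocks pass through each point of the
   truncated group. *)
have phi_bij : bijective (fun b => (z b, l (lift ord_max (Ordinal k0)) b)).
  apply: inj_card_bij => [b b' [e1 e2]|].
    exact: lP (neq_lift _ _) e1 e2.
  by rewrite card_prod lB !card_ord.
have cz : #|[pred b | (z b < u)%N]| = (u * t)%N.
  transitivity #|finset.setX [set x : 'I_t | (x < u)%N] [set: 'I_t]|.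
    rewrite -(on_card_preimset (onW_bij _ phi_bij)) -cardsE.
    by apply: eq_card => b; rewrite !inE andbT.
  rewrite cardsX cardsT card_ord -sum1dep_card (big_ord_narrow ut) /=.
  by rewrite sum1_card card_ord.
have czC : #|[pred b | ~~ (z b < u)%N]| = ((t - u) * t)%N.
  have := cardC [pred b | (z b < u)%N]; rewrite cz lB card_ord => czz.
  rewrite mulnBl -mulnn in czz *; rewrite -czz addnC addnK.
  by apply: eq_card => b; rewrite !inE.
split.
  (* The count is (t - u) t m^2 + u t ((m + 1)^2 - 1) + u^2 = (m t + u)^2. *)
  rewrite !card_sum !card_prod !card_sig cz czC eB gB (cardC1 f0) fB !card_ord.
  have -> : (m.+1 ^ 2).-1 = (m * (m + 2))%N by rewrite -mulnn; lia.
  have : (t = (t - u) + u)%N by rewrite subnK.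
  move: (t - u)%N => v ->; lia.
move=> i j b b' ij; rewrite /c.
have lij b1 b2 : l (lift ord_max i) b1 = l (lift ord_max i) b2 ->
    l (lift ord_max j) b1 = l (lift ord_max j) b2 -> b1 = b2.
  exact: lP (liftM _ _ ij).
have lz (n : 'I_k) b1 b2 : l (lift ord_max n) b1 = l (lift ord_max n) b2 ->
    z b1 = z b2 -> b1 = b2.
  by apply: lP; rewrite eq_sym neq_lift.
have ff (b1 b2 : Bm1) : f i b1 = f i b2 -> f j b1 = f j b2 -> b1 = b2.
  exact: fP ij.
(* A row other than [f0] cannot show the new point in two columns, since [f0] already does. *)
have fN (r : {r : Bm1 | r != f0}) : unlift ord_max (f i (sval r)) = None ->
    unlift ord_max (f j (sval r)) = None -> False.
  move=> /fmax e1 /fmax e2; have := valP r.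
  by rewrite (ff _ _ e1 e2 : val r = f0) eqxx.
case: b b' => [[b r]|[[b r]|r]] [[b' r']|[[b' r']|r']] //=.
- by move=> [l1 e1] [l2 e2]; rewrite (val_inj (lij _ _ l1 l2)) (eP _ _ _ _ ij e1 e2).
- case: unliftP => // s _ [l1 _]; case: unliftP => // s' _ [l2 _].
  by have := valP b; rewrite (lij _ _ l1 l2 : val b = val b') (valP b').
- case: unliftP => // s _ [l1 _]; case: unliftP => // s' _ [l2 _].
  by have := valP b'; rewrite -(lij _ _ l1 l2 : val b = val b') (valP b).
- case Ui: (unlift ord_max (f i (sval r))) => [s|];
    case Ui': (unlift ord_max (f i (sval r'))) => [s'|] //;
    case Uj: (unlift ord_max (f j (sval r))) => [v|];
    case Uj': (unlift ord_max (f j (sval r'))) => [v'|] //.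
  + move=> [e1 e1'] [e2 e2'].
    rewrite (val_inj (lij _ _ e1 e2)); rewrite e1' in Ui; rewrite e2' in Uj.
    by rewrite (val_inj (ff _ _ (fS _ _ _ _ Ui Ui') (fS _ _ _ _ Uj Uj'))).
  + move=> [e1 e1'] [/val_inj e2].
    rewrite (val_inj (lz _ _ _ e1 e2)); rewrite e1' in Ui.
    have fj : f j (sval r) = f j (sval r') by rewrite (fmax _ _ Uj) (fmax _ _ Uj').
    by rewrite (val_inj (ff _ _ (fS _ _ _ _ Ui Ui') fj)).
  + move=> [/val_inj e1] [e2 e2'].
    rewrite (val_inj (lz _ _ _ e2 e1)); rewrite e2' in Uj.
    have fi : f i (sval r) = f i (sval r') by rewrite (fmax _ _ Ui) (fmax _ _ Ui').
    by rewrite (val_inj (ff _ _ fi (fS _ _ _ _ Uj Uj'))).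
  + by case: (fN r).
- case Ui: (unlift ord_max (f i (sval r))) => // _.
  by case Uj: (unlift ord_max (f j (sval r))) => // _; case: (fN r).
- case Ui: (unlift ord_max (f i (sval r'))) => // _.
  by case Uj: (unlift ord_max (f j (sval r'))) => // _; case: (fN r').
- by move=> [e1] [e2]; rewrite (gP _ _ _ _ ij e1 e2).
Qed.

(** The development of a quasi-difference matrix over Z/n; [inf] supplies the rows lying entirely on
    the points at infinity. *)
Definition qdm_rows (n : nat) (base inf : seq (seq nat)) : seq (seq nat) :=
  [seq [seq if (x < n)%N then ((x + g) %% n)%N else x | x <- r] |
     g <- iota 0 n, r <- base] ++ inf.

Definition oa_check (k n : nat) (rows : seq (seq nat)) : bool :=
  [&& size rows == (n * n)%N,
      all (fun r => all (fun x => (x < n)%N) r && (size r == k)) rows &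
      all (fun i => all (fun j => (i == j) ||
        uniq [seq (nth 0%N r i * n + nth 0%N r j)%N | r <- rows]) (iota 0 k))
        (iota 0 k)].

Lemma has_oa_check (k n : nat) rows : oa_check k n.+1 rows -> has_oa k n.+1.
Proof.
case/and3P => /eqP srows /allP lt_rows /allP uni.
pose c (i : 'I_k) (b : 'I_(size rows)) : 'I_n.+1 :=
  inord (nth 0%N (nth [::] rows b) i).
(* The range check in [oa_check] keeps [inord] from falling back on its default value. *)
have cE (i : 'I_k) b : c i b = nth 0%N (nth [::] rows b) i :> nat.
  have /andP[/allP lt_r /eqP sr] := lt_rows _ (mem_nth [::] (ltn_ord b)).
  by rewrite inordK // lt_r // mem_nth // sr.
apply: (has_oaW _ _ _ _ c); first by rewrite card_ord.
split=> [|i j b b' ij ei ej]; first by rewrite !card_ord srows.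
have := uni i; rewrite mem_iota ltn_ord => /(_ isT) /allP /(_ j).
rewrite mem_iota ltn_ord => /(_ isT) /orP[|u]; first by rewrite val_eqE (negPf ij).
apply/ord_inj/eqP; rewrite -(nth_uniq 0%N _ _ u) ?size_map //.
by rewrite !(nth_map [::]) // -!cE ei ej.
Qed.

(* In a base row for qdm_rows n, the entry n + i stands for the i-th point
   fixed by the translations of Z/n; the base rows below were found by computer
   search. *)
Lemma has_oa_4 : has_oa 4 4.
Proof.
apply: (has_oa_check _ _ (qdm_rows 3 [:: [:: 0; 0; 0; 0]; [:: 3; 0; 1; 2];
  [:: 0; 3; 2; 1]; [:: 0; 1; 3; 2]; [:: 0; 2; 1; 3]] [:: [:: 3; 3; 3; 3]]))%N.
by vm_compute.
Qed.

Lemma has_oa_8 : has_oa 4 8.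
Proof.
apply: (has_oa_check _ _ (qdm_rows 7 [:: [:: 0; 0; 0; 0]; [:: 7; 0; 1; 2];
  [:: 0; 7; 3; 6]; [:: 0; 2; 7; 3]; [:: 0; 4; 2; 7]; [:: 0; 1; 5; 4];
  [:: 0; 3; 6; 1]; [:: 0; 5; 4; 2]; [:: 0; 6; 1; 5]] [:: [:: 7; 7; 7; 7]]))%N.
by vm_compute.
Qed.

(** The affine array of order 3, placed on the three points at infinity. *)
Definition oa3_rows (n : nat) : seq (seq nat) :=
  [seq [:: n + x; n + y; n + (x + y) %% 3; n + (x + 2 * y) %% 3]%N |
     x <- iota 0 3, y <- iota 0 3].

(** Z/7 with three points at infinity; the base rows are closed under cyclic shifts of the columns.
    The array of order 14 has the same form over Z/11. *)
Lemma has_oa_10 : has_oa 4 10.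
Proof.
apply: (has_oa_check _ _ (qdm_rows 7 ([:: 0; 0; 0; 0] ::
  [seq rot k r | r <- [:: [:: 7; 0; 1; 4]; [:: 8; 0; 2; 1]; [:: 9; 0; 4; 2]],
                 k <- iota 0 4]) (oa3_rows 7)))%N.
by vm_compute.
Qed.

Lemma has_oa_14 : has_oa 4 14.
Proof.
apply: (has_oa_check _ _ (qdm_rows 11 ([:: 0; 0; 0; 0] ::
  [seq rot k r | r <- [:: [:: 0; 1; 4; 6]; [:: 11; 0; 4; 1]; [:: 12; 0; 6; 2];
                          [:: 13; 0; 9; 8]], k <- iota 0 4]) (oa3_rows 11)))%N.
by vm_compute.
Qed.

(** The slopes 0, 1, 2 and infinity suffice: their differences 1 and 2 are units modulo an odd n. *)
Lemma has_oa_odd (n : nat) : odd n -> has_oa 4 n.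
Proof.
case: n => [|[_|n on]] //; first exact: has_oa1.
apply: has_oa_linear => // -[|[|[|]]] // _; first exact: coprimen1.
by rewrite coprimen2.
Qed.

Theorem bose_shrikhande_parker (n : nat) : (2 < n)%N -> n != 6 -> has_oa 4 n.
Proof.
have [on _ _|en] := boolP (odd n); first exact: has_oa_odd.
(* Wilson's construction with m = 3. The array of order t needs a fifth column, hence slope
   differences 1, 2 and 3, which are prime to t. *)
have wilson t u : coprime t 6 -> odd u -> (1 < t)%N -> (u <= t)%N ->
    has_oa 4 (3 * t + u).
  rewrite (coprimeMr t 2 3) => /andP[t2 t3] ou t1 ut; apply: has_oa_wilson => //.
  - exact: has_oa_odd.
  - exact: has_oa_4.
  - by apply: has_oa_linear => // -[|[|[|[|]]]] // _; rewrite ?coprimen1.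
  - exact: has_oa_odd.
have [n34 _ _|n34 n2 n6] := leqP 34 n; last first.
  have pr m m' : has_oa 4 m -> has_oa 4 m' -> has_oa 4 (m * m').
    exact: has_oa_prod.
  have oa3 : has_oa 4 3 by exact: has_oa_odd.
  have /= : n \in [seq i <- iota 0 34 | [&& ~~ odd i, 2 < i & i != 6]%N].
    by rewrite mem_filter en n2 n6 mem_iota.
  (* The even orders 4, 8, 10, ..., 32 in turn; those from 16 to 28 are 3 t + u with t = 5 or t =
     7. *)
  rewrite !inE; do 13? [case/orP]; move/eqP->.
  - exact: has_oa_4.
  - exact: has_oa_8.
  - exact: has_oa_10.
  - exact: (pr 3 4 oa3 has_oa_4).
  - exact: has_oa_14.
  - exact: (wilson 5 1).
  - exact: (wilson 5 3).
  - exact: (wilson 5 5).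
  - exact: (wilson 7 1).
  - exact: (wilson 7 3).
  - exact: (wilson 7 5).
  - exact: (wilson 7 7).
  - exact: (pr 3 10 oa3 has_oa_10).
  - exact: (pr 4 8 has_oa_4 has_oa_8).
(* The gaps between consecutive integers coprime to 6 are at most 4. *)
have cop k r : coprime (6 * k + r) 6 = coprime r 6.
  by rewrite /coprime -gcdn_modl mulnC modnMDl gcdn_modl.
(* 34 = 3 * 11 + 1, and increasing t by 6 increases 3 t by 18. As r is even, u = r + 1 is odd and at
   most 11 for r < 12, which fits t = 6 k + 11; for larger r, u = r - 5 is odd and at most 11, which
   fits t = 6 k + 13. *)
have [k [r [r18 nE]]] : exists k r, (r < 18)%N /\ n = (34 + 18 * k + r)%N.
  exists ((n - 34) %/ 18)%N, ((n - 34) %% 18)%N; split; first by rewrite ltn_mod.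
  by have := divn_eq (n - 34) 18; lia.
have er : ~~ odd r by move: en; rewrite nE; lia.
have [r12|r12] := ltnP r 12.
  have -> : n = (3 * (6 * k + 11) + r.+1)%N by lia.
  by apply: wilson; rewrite ?cop //=; lia.
have -> : n = (3 * (6 * k + 13) + (r - 5))%N by lia.
apply: wilson; rewrite ?cop //; lia.
Qed.

(** * Tensors invariant under unitaries *)

Section InvariantTensor.
Context {C : numClosedFieldType} {d : nat}.
Implicit Types (M : 'I_d -> 'I_d -> 'I_d -> 'I_d -> C) (V : 'M[C]_d).

(** The action of V on two indices and of its conjugate on the other two, nested so that the sums
    can be evaluated one at a time. *)
Definition tensor_act V M (m1 m2 m3 m4 : 'I_d) : C :=
  \sum_k1 V m1 k1 * \sum_k2 V m2 k2 *
    \sum_k3 (V m3 k3)^* * \sum_k4 (V m4 k4)^* * M k1 k2 k3 k4.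

Lemma diag_unitary (v : 'rV[C]_d) :
  (forall j, v 0 j * (v 0 j)^* = 1) -> diag_mx v \is unitarymx.
Proof.
move=> v1; apply/unitarymxP; apply/matrixP => i j.
rewrite mul_diag_mx !mxE; case: (eqVneq j i) => [->|ji].
  by rewrite mulr1n v1.
by rewrite mulr0n conjC0 mulr0.
Qed.

Lemma perm_unitary (s : 'S_d) : (perm_mx s : 'M[C]_d) \is unitarymx.
Proof.
apply/unitarymxP; rewrite (_ : (perm_mx s)^t* = perm_mx s^-1).
  by rewrite -perm_mxM mulgV perm_mx1.
by rewrite -tr_perm_mx; apply/matrixP => i j; rewrite !mxE conjC_nat.
Qed.

(* The Householder reflection whose restriction to the coordinates i0, i1 is
   [[3/5, 4/5], [4/5, -3/5]]. *)
Definition reflection (i0 i1 : 'I_d) : 'M[C]_d :=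
  let w i : C := 2 * (i == i1)%:R - (i == i0)%:R in
  \matrix_(i, j) ((i == j)%:R - 2 / 5 * w i * w j).

Lemma sum_delta (i0 : 'I_d) (f : 'I_d -> C) : \sum_k (i0 == k)%:R * f k = f i0.
Proof.
rewrite (bigD1 i0) //= eqxx mul1r big1 ?addr0 // => k ki.
by rewrite eq_sym (negPf ki) mul0r.
Qed.

Lemma reflection_row (i0 i1 : 'I_d) (f : 'I_d -> C) : i0 != i1 ->
  \sum_k reflection i0 i1 i0 k * f k = 3 / 5 * f i0 + 4 / 5 * f i1.
Proof.
move=> i01; have -> : \sum_k reflection i0 i1 i0 k * f k =
   \sum_k ((i0 == k)%:R * f k + (4 / 5 * ((i1 == k)%:R * f k) -
     2 / 5 * ((i0 == k)%:R * f k))).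
  apply: eq_bigr => k _; rewrite !mxE eqxx (negPf i01) ![k == _]eq_sym /=.
  by field.
by rewrite big_split /= sumrB -!mulr_sumr !sum_delta; field.
Qed.

Lemma reflection_unitary (i0 i1 : 'I_d) : i0 != i1 ->
  reflection i0 i1 \is unitarymx.
Proof.
move=> i01; apply/unitarymxP/matrixP => i j; rewrite !mxE.
pose w (i : 'I_d) : C := 2 * (i == i1)%:R - (i == i0)%:R.
have ww : \sum_k w k * w k = 5.
  rewrite (bigD1 i0) //= (bigD1 i1) 1?eq_sym //= big1.
    by rewrite /w !eqxx (negPf i01) eq_sym (negPf i01) /=; ring.
  by move=> k /andP[k0 k1]; rewrite /w (negPf k0) (negPf k1) /=; ring.
transitivity (\sum_k ((i == k)%:R * (j == k)%:R - 2 / 5 * w j * ((i == k)%:R * w k)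
   - 2 / 5 * w i * ((j == k)%:R * w k) + 4 / 25 * w i * w j * (w k * w k))).
  apply: eq_bigr => k _; rewrite !mxE -/(w i) -/(w j) -/(w k).
  have -> : ((j == k)%:R - 2 / 5 * w j * w k)^* = (j == k)%:R - 2 / 5 * w j * w k.
    by rewrite /w !rmorphB !rmorphM !rmorphB /= fmorphV !rmorphM /= !conjC_nat.
  by field.
rewrite big_split /= !sumrB -!mulr_sumr ww !sum_delta eq_sym.
by field.
Qed.

Section Invariance.
Variable M : 'I_d -> 'I_d -> 'I_d -> 'I_d -> C.
Hypothesis M_inv : forall V, V \is unitarymx ->
  forall m1 m2 m3 m4, tensor_act V M m1 m2 m3 m4 = M m1 m2 m3 m4.

Lemma invariant_diag (v : 'rV[C]_d) m1 m2 m3 m4 :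
  (forall j, v 0 j * (v 0 j)^* = 1) ->
  v 0 m1 * (v 0 m2 * ((v 0 m3)^* * ((v 0 m4)^* * M m1 m2 m3 m4))) = M m1 m2 m3 m4.
Proof.
move=> /diag_unitary /M_inv /(_ m1 m2 m3 m4) e; rewrite -[RHS]e.
have S m (f : 'I_d -> C) : \sum_k diag_mx v m k * f k = v 0 m * f m.
  rewrite -(sum_delta m (fun k => v 0 k * f k)); apply: eq_bigr => k _.
  by rewrite mxE; case: eqP => [->|_]; rewrite ?mulr1n ?mulr0n !(mul1r, mul0r).
have S' m (f : 'I_d -> C) : \sum_k (diag_mx v m k)^* * f k = (v 0 m)^* * f m.
  rewrite -(sum_delta m (fun k => (v 0 k)^* * f k)); apply: eq_bigr => k _.
  by rewrite mxE; case: eqP => [->|_]; rewrite ?mulr1n ?mulr0n ?conjC0 !(mul1r, mul0r).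
by rewrite /tensor_act S S S' S'.
Qed.

Lemma invariant_perm (s : 'S_d) m1 m2 m3 m4 :
  M (s m1) (s m2) (s m3) (s m4) = M m1 m2 m3 m4.
Proof.
rewrite -[RHS](M_inv _ (perm_unitary s)).
have S m (f : 'I_d -> C) : \sum_k (perm_mx s : 'M[C]_d) m k * f k = f (s m).
  by rewrite -[RHS]sum_delta; apply: eq_bigr => k _; rewrite !mxE.
have S' m (f : 'I_d -> C) : \sum_k ((perm_mx s : 'M[C]_d) m k)^* * f k = f (s m).
  by rewrite -[RHS]sum_delta; apply: eq_bigr => k _; rewrite !mxE conjC_nat.
by rewrite /tensor_act S S S' S'.
Qed.

(** The diagonal unitary with ['i] at position a and 1 elsewhere multiplies the entry by a power of
    ['i], whose exponent counts a among m1, m2 minus a among m3, m4. This exponent lies between -2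
    and 2, so it vanishes when the entry does not, and the two pairs of indices agree as
    multisets. *)
Lemma invariant_support m1 m2 m3 m4 : M m1 m2 m3 m4 != 0 ->
  (m1 == m3) && (m2 == m4) || (m1 == m4) && (m2 == m3).
Proof.
move=> M0.
have count a : ((m1 == a) + (m2 == a) = (m3 == a) + (m4 == a))%N.
  pose v : 'rV[C]_d := \row_j (if j == a then 'i else 1).
  have v1 j : v 0 j * (v 0 j)^* = 1.
    by rewrite mxE; case: ifP; rewrite ?conjCi ?rmorph1 ?mulr1 // mulrN mulCii opprK.
  have := invariant_diag v m1 m2 m3 m4 v1; rewrite !mxE.
  move/eqP; rewrite -subr_eq0 !mulrA -{2}[M _ _ _ _]mul1r -mulrBl mulf_eq0.
  rewrite (negPf M0) orbF.
  have iN (x : C) : x * x = 1 -> ('i == x) = false.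
    move=> xx; apply/negP => /eqP ix; have := @mulCii C; rewrite ix xx => /eqP.
    by rewrite eq_sym eqNr oner_eq0.
  have i1 := iN 1 (mul1r 1); have iN1 := iN (-1) ltac:(by rewrite mulrNN mulr1).
  case: (m1 == a) (m2 == a) (m3 == a) (m4 == a) => [] [] [] [];
    rewrite ?conjCi ?rmorph1 ?(mulr1, mul1r, mulrN, mulNr, mulCii, opprK) //;
    by rewrite ?mulCii subr_eq0 ?eqr_oppLR ?i1 ?iN1 ?[1 == _]eq_sym ?eqNr ?oner_eq0.
have := count m2; have := count m1; rewrite !eqxx.
rewrite ![m1 == _]eq_sym [m2 == m3]eq_sym [m2 == m4]eq_sym.
case: (eqVneq m2 m1) => [->|n12]; first by do 2! case: (_ == m1).
case: (eqVneq m3 m1) => [->|n31] /=.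
  rewrite ![m1 == m2]eq_sym (negPf n12); case: (m4 == m1) => // _.
  by case: (m4 == m2).
case: (eqVneq m4 m1) => [->|//].
by rewrite [m1 == m2]eq_sym (negPf n12); case: (m3 == m2).
Qed.

(** Diagonal unitaries restrict the support, permutations leave only the three values p, q, r on it,
    and one rotation-like unitary mixing two coordinates relates them by p = q + r. *)
Lemma invariant_tensor : (1 < d)%N -> exists q r, forall m1 m2 m3 m4,
  M m1 m2 m3 m4 = q * ((m1 == m3) && (m2 == m4))%:R
                + r * ((m1 == m4) && (m2 == m3))%:R.
Proof.
move=> d1; pose i0 := Ordinal (ltnW d1); pose i1 := Ordinal d1.
have i01 : i0 != i1 by [].
pose p := M i0 i0 i0 i0; pose q := M i0 i1 i0 i1; pose r := M i0 i1 i1 i0.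
have Mp i : M i i i i = p by rewrite -(invariant_perm (tperm i i0)) tpermL.
have two i j : i != j -> exists s : 'S_d, s i = i0 /\ s j = i1.
  move=> ij; exists (tperm i i0 * tperm (tperm i i0 j) i1)%g.
  rewrite !permM tpermL; split; last by rewrite tpermL.
  rewrite tpermD // -{2}(tpermL i i0) (inj_eq perm_inj) eq_sym //.
have Mq i j : i != j -> M i j i j = q.
  by case/two => s [si sj]; rewrite -(invariant_perm s) si sj.
have Mr i j : i != j -> M i j j i = r.
  by case/two => s [si sj]; rewrite -(invariant_perm s) si sj.
have M0 m1 m2 m3 m4 : ~~ ((m1 == m3) && (m2 == m4) || (m1 == m4) && (m2 == m3)) ->
    M m1 m2 m3 m4 = 0.
  by move=> H; apply/eqP; apply: contraNT H => /invariant_support.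
have pqr : p = q + r.
  have := M_inv _ (reflection_unitary i0 i1 i01) i0 i0 i0 i0.
  have R' (f : 'I_d -> C) : \sum_k (reflection i0 i1 i0 k)^* * f k =
      3 / 5 * f i0 + 4 / 5 * f i1.
    rewrite -reflection_row //; apply: eq_bigr => k _; congr (_ * _).
    rewrite !mxE !rmorphB !rmorphM !rmorphB /= fmorphV !rmorphM /= !conjC_nat.
    by [].
  rewrite /tensor_act !(reflection_row _ _ _ i01) !R'.
  rewrite !Mp !Mq ?Mr // 1?eq_sym // !(M0 i0 i0) // !(M0 i1 i1) //.
  rewrite !(M0 _ _ i0 i0) // !(M0 _ _ i1 i1) //.
  (* With c = 3/5 and s = 4/5 the invariance reads p = (c^4 + s^4) p + 2 c^2 s^2 (q + r), and 1 -
     c^4 - s^4 = 2 c^2 s^2 = 288/625. *)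
  clearbody p q r => e; apply/eqP; rewrite -subr_eq0.
  have /eqP : 288 / 625 * (p - (q + r)) = 0 by rewrite -(subrr p) -{3}e; field.
  by rewrite mulf_eq0 mulf_eq0 invr_eq0 !pnatr_eq0.
exists q, r => m1 m2 m3 m4.
have [|H] := boolP ((m1 == m3) && (m2 == m4) || (m1 == m4) && (m2 == m3)).
  case/orP => /andP[/eqP <- /eqP <-]; have [<-|n12] := eqVneq m1 m2.
  - by rewrite Mp pqr !eqxx !mulr1.
  - by rewrite Mq // !eqxx /= mulr1 mulr0 addr0.
  - by rewrite Mp pqr !eqxx !mulr1.
  - by rewrite Mr // !eqxx /= mulr1 mulr0 add0r.
rewrite M0 //; move: H; rewrite negb_or => /andP[/negbTE-> /negbTE->].
by rewrite !mulr0 addr0.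
Qed.

(** The contractions are t1 = d^2 q + d r and t2 = d q + d^2 r; q and r solve this system, of
    determinant d^2 (d^2 - 1). *)
Lemma invariant_tensorE : (1 < d)%N ->
  let t1 := \sum_m1 \sum_m2 M m1 m2 m1 m2 in
  let t2 := \sum_m1 \sum_m2 M m1 m2 m2 m1 in
  forall m1 m2 m3 m4, M m1 m2 m3 m4 =
    (d%:R * t1 - t2) / (d%:R * (d%:R ^+ 2 - 1)) * ((m1 == m3) && (m2 == m4))%:R
  + (d%:R * t2 - t1) / (d%:R * (d%:R ^+ 2 - 1)) * ((m1 == m4) && (m2 == m3))%:R.
Proof.
move=> d1 t1 t2 m1 m2 m3 m4.
have [q [r Mqr]] := invariant_tensor d1.
have d0 : d%:R != 0 :> C by rewrite pnatr_eq0 -lt0n ltnW.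
have d21 : d%:R ^+ 2 - 1 != 0 :> C.
  by rewrite subr_eq0 -natrX pnatr_eq1; case: (d) d1 => [|[|?]].
have sum1 : \sum_(m < d) \sum_(m' < d) (1 : C) = d%:R ^+ 2.
  by rewrite !sumr_const !card_ord -mulrnA mulnn natrX.
have sumD : \sum_(m < d) \sum_(m' < d) ((m == m') && (m' == m))%:R = d%:R :> C.
  rewrite -[RHS]mulr1 -[d in RHS]card_ord mulr_natl -sumr_const.
  apply: eq_bigr => m _; rewrite (bigD1 m) //= eqxx big1 ?addr0 // => m' mm'.
  by rewrite eq_sym (negPf mm').
have -> : t1 = q * d%:R ^+ 2 + r * d%:R.
  rewrite -sum1 -sumD !mulr_sumr -big_split; apply: eq_bigr => m _ /=.
  rewrite !mulr_sumr -big_split; apply: eq_bigr => m' _ /=.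
  by rewrite Mqr !eqxx.
have -> : t2 = q * d%:R + r * d%:R ^+ 2.
  rewrite -sum1 -sumD !mulr_sumr -big_split; apply: eq_bigr => m _ /=.
  rewrite !mulr_sumr -big_split; apply: eq_bigr => m' _ /=.
  by rewrite Mqr !eqxx.
rewrite Mqr; congr (_ * _ + _ * _); field; rewrite d0 d21 //.
Qed.

End Invariance.
End InvariantTensor.

(** * Purity *)

Lemma mul4_sum (A : comPzSemiRingType) (I : finType) (f1 f2 f3 f4 : I -> A) :
  (\sum_i f1 i) * (\sum_i f2 i) * (\sum_i f3 i) * (\sum_i f4 i) =
  \sum_(w : I * I * I * I) f1 w.1.1.1 * f2 w.1.1.2 * f3 w.1.2 * f4 w.2.
Proof.
have mul2 (J : finType) (f : J -> A) (g : I -> A) :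
    (\sum_j f j) * (\sum_i g i) = \sum_(w : J * I) f w.1 * g w.2.
  by rewrite big_distrlr pair_bigA.
by rewrite !mul2.
Qed.

Section Purity.
Context {C : numClosedFieldType} {d : nat}.
Local Notation J := ('I_d * 'I_d)%type.
Implicit Types (phi : J -> C) (u : J -> J -> C).

(** [Tr rho^2] for the reduced state rho of phi, expanded with x = (a, b) and y = (a', b'). *)
Definition purity phi : C :=
  \sum_(x : J) \sum_(y : J)
    phi x * phi y * (phi (y.1, x.2))^* * (phi (x.1, y.2))^*.

Definition tensor2 phi (w : J * J * J * J) : C :=
  phi w.1.1.1 * phi w.1.1.2 * (phi w.1.2)^* * (phi w.2)^*.

Definition purity_kernel u (w : J * J * J * J) : C :=
  \sum_(x : J) \sum_(y : J) u x w.1.1.1 * u y w.1.1.2 *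
    (u (y.1, x.2) w.1.2)^* * (u (x.1, y.2) w.2)^*.

Lemma purity_apply u phi :
  purity (fun x => \sum_p u x p * phi p) =
  \sum_w purity_kernel u w * tensor2 phi w.
Proof.
rewrite /purity /purity_kernel.
under [RHS]eq_bigr do rewrite mulr_suml.
rewrite [RHS]exchange_big /=.
apply: eq_bigr => x _; under [RHS]eq_bigr do rewrite mulr_suml.
rewrite [RHS]exchange_big /=; apply: eq_bigr => y _.
rewrite !rmorph_sum mul4_sum; apply: eq_bigr => w _.
by rewrite /tensor2 !rmorphM /=; ring.
Qed.

(* The shape of the mean of [tensor2 phi] over random phi: the indices of the
   starred factors are those of the unstarred ones, matched in one of two ways
   in each tensor factor; b weights the mixed matchings. *)
Definition purity_moment (a b : C) (w : J * J * J * J) : C :=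
  let: (p1, p2, p3, p4) := w in
  a * (((p3 == p1) && (p4 == p2))%:R + ((p3 == p2) && (p4 == p1))%:R) +
  b * (((p3 == (p1.1, p2.2)) && (p4 == (p2.1, p1.2)))%:R
     + ((p3 == (p2.1, p1.2)) && (p4 == (p1.1, p2.2)))%:R).

Definition gram u (x y : J) : C := \sum_z u x z * (u y z)^*.

(** The squared Hilbert-Schmidt norm of the Gram matrix of the rows of u. *)
Definition gram_norm u : C := \sum_x \sum_y gram u x y * (gram u x y)^*.

(** Both reshuffles split the four indices of u into new rows and columns: here a row is (first
    output, second input), in [partial_transpose] it is (first output, first input). *)
Definition realign u (x z : J) : C := u (x.1, z.1) (z.2, x.2).
Definition partial_transpose u (x z : J) : C := u (x.1, z.1) (x.2, z.2).

Lemma sum_match (K : J * J * J * J -> C) (g h : J -> J -> J) :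
  \sum_w K w * (let: (p1, p2, p3, p4) := w in
     ((p3 == g p1 p2) && (p4 == h p1 p2))%:R) =
  \sum_p1 \sum_p2 K (p1, p2, g p1 p2, h p1 p2).
Proof.
rewrite !pair_bigA /=.
rewrite (bigID (fun w : J * J * J * J => (w.1.2 == g w.1.1.1 w.1.1.2) &&
   (w.2 == h w.1.1.1 w.1.1.2))) /= [X in _ + X]big1 ?addr0; last first.
  by move=> [[[p1 p2] p3] p4] /= /negbTE ->; rewrite mulr0.
rewrite (reindex (fun p : J * J => (p.1, p.2, g p.1 p.2, h p.1 p.2))) /=.
  by apply: eq_big => [p|p _]; rewrite !eqxx //= mulr1.
exists (fun w : J * J * J * J => w.1.1) => [[]//|[[[p1 p2] p3] p4]] /=.
by case/andP=> /= /eqP -> /eqP ->.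
Qed.

(** In the two unmixed matchings the sums over p1 and p2 produce Gram entries of u, which are
    deltas, and each matching contributes d^3. In the mixed ones the same sums regroup into Gram
    norms of the two reshuffles. *)
Lemma sum_purity_moment u a b :
  (forall x y, gram u x y = (x == y)%:R) ->
  \sum_w purity_kernel u w * purity_moment a b w =
  a * (2 * d%:R ^+ 3) +
  b * (gram_norm (realign u) + gram_norm (partial_transpose u)).
Proof.
move=> gu.
have sum_fst (i : 'I_d) : \sum_(y : J) (i == y.1)%:R = d%:R :> C.
  rewrite -(pair_bigA _ (fun y1 y2 => (i == y1)%:R)) (bigD1 i) //= eqxx.
  rewrite sumr_const card_ord big1 ?addr0 // => j ji.
  by rewrite big1 // => k _; rewrite eq_sym (negPf ji).
have sum_snd (i : 'I_d) : \sum_(y : J) (i == y.2)%:R = d%:R :> C.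
  rewrite -(pair_bigA _ (fun y1 y2 => (i == y2)%:R)) exchange_big (bigD1 i) //= eqxx.
  rewrite sumr_const card_ord big1 ?addr0 // => j ji.
  by rewrite big1 // => k _; rewrite eq_sym (negPf ji).
have sum_cst : \sum_(x : J) (d%:R : C) = d%:R ^+ 3.
  by rewrite sumr_const card_prod card_ord -mulrnA -natrX; congr _%:R; lia.
have K11 : \sum_p1 \sum_p2 purity_kernel u (p1, p2, p1, p2) = d%:R ^+ 3.
  rewrite /purity_kernel /=.
  transitivity (\sum_(x : J) \sum_(y : J) gram u x (y.1, x.2) * gram u y (x.1, y.2)).
    rewrite /purity_kernel !pair_bigA /=.
    under [RHS]eq_bigr do rewrite /gram big_distrlr pair_bigA /=.
    rewrite !pair_bigA /=.
    rewrite (reindex (fun t : (J * J) * (J * J) => let: ((x, y), (z, z')) := t in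
      (z, z', x, y))) /=.
      by apply: eq_bigr => [[[x y] [z z']]] _ /=; ring.
    exists (fun t : J * J * J * J => let: (p1, p2, x, y) := t in
      ((x, y), (p1, p2))).
      by move=> [[[? ?] [? ?]] [[? ?] [? ?]]] _.
    by move=> [[[[? ?] [? ?]] [? ?]] [? ?]] _.
  rewrite -sum_cst; apply: eq_bigr => -[x1 x2] _; rewrite -[RHS](sum_fst x1).
  apply: eq_bigr => -[y1 y2] _; rewrite !gu !xpair_eqE !eqxx /= andbT.
  by rewrite [y1 == x1]eq_sym -natrM mulnb andbT andbb.
have K22 : \sum_p1 \sum_p2 purity_kernel u (p1, p2, p2, p1) = d%:R ^+ 3.
  transitivity (\sum_(x : J) \sum_(y : J) gram u x (x.1, y.2) * gram u y (y.1, x.2)).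
    rewrite /purity_kernel !pair_bigA /=.
    under [RHS]eq_bigr do rewrite /gram big_distrlr pair_bigA /=.
    rewrite !pair_bigA /=.
    rewrite (reindex (fun t : (J * J) * (J * J) => let: ((x, y), (z, z')) := t in
      (z, z', x, y))) /=.
      by apply: eq_bigr => [[[x y] [z z']]] _ /=; ring.
    exists (fun t : J * J * J * J => let: (p1, p2, x, y) := t in
      ((x, y), (p1, p2))).
      by move=> [[[? ?] [? ?]] [[? ?] [? ?]]] _.
    by move=> [[[[? ?] [? ?]] [? ?]] [? ?]] _.
  rewrite -sum_cst; apply: eq_bigr => -[x1 x2] _; rewrite -[RHS](sum_snd x2).
  apply: eq_bigr => -[y1 y2] _; rewrite !gu !xpair_eqE !eqxx /=.
  by rewrite [y2 == x2]eq_sym -natrM mulnb andbb.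
have K12 : \sum_(p1 : J) \sum_(p2 : J)
    purity_kernel u (p1, p2, (p1.1, p2.2), (p2.1, p1.2)) = gram_norm (realign u).
  rewrite /purity_kernel /gram_norm !pair_bigA /=.
  under [RHS]eq_bigr do rewrite /gram rmorph_sum big_distrlr pair_bigA /=.
  rewrite !pair_bigA /=.
  (* x and y become the row indices of the reshuffled matrix, z and z' its summed column indices. *)
  rewrite (reindex (fun t : (J * J) * (J * J) => let: ((x, y), (z, z')) := t in
    (((z.2, x.2), (z'.2, y.2)), (x.1, z.1), (y.1, z'.1)))) /=.
    apply: eq_bigr => [[[x y] [z z']]] _ /=.
    by rewrite /realign /= rmorphM /= conjCK; ring.
  exists (fun t : J * J * J * J => let: (p1, p2, x, y) := t in
    (((x.1, p1.2), (y.1, p2.2)), ((x.2, p1.1), (y.2, p2.1)))).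
    by move=> [[[? ?] [? ?]] [[? ?] [? ?]]] _.
  by move=> [[[[? ?] [? ?]] [? ?]] [? ?]] _.
have K21 : \sum_(p1 : J) \sum_(p2 : J)
    purity_kernel u (p1, p2, (p2.1, p1.2), (p1.1, p2.2)) =
    gram_norm (partial_transpose u).
  rewrite /purity_kernel /gram_norm !pair_bigA /=.
  under [RHS]eq_bigr do rewrite /gram rmorph_sum big_distrlr pair_bigA /=.
  rewrite !pair_bigA /=.
  rewrite (reindex (fun t : (J * J) * (J * J) => let: ((x, y), (z, z')) := t in
    (((x.2, z.2), (y.2, z'.2)), (x.1, z.1), (y.1, z'.1)))) /=.
    apply: eq_bigr => [[[x y] [z z']]] _ /=.
    by rewrite /partial_transpose /= rmorphM /= conjCK; ring.
  exists (fun t : J * J * J * J => let: (p1, p2, x, y) := t in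
    (((x.1, p1.1), (y.1, p2.1)), ((x.2, p1.2), (y.2, p2.2)))).
    by move=> [[[? ?] [? ?]] [[? ?] [? ?]]] _.
  by move=> [[[[? ?] [? ?]] [? ?]] [? ?]] _.
rewrite -K12 -K21 (_ : 2 * _ = d%:R ^+ 3 + d%:R ^+ 3); last by ring.
rewrite -{1}K11 -K22 -!sum_match -!big_split /= !mulr_sumr -big_split /=.
by apply: eq_bigr => -[[[p1 p2] p3] p4] _; rewrite /purity_moment; ring.
Qed.

(* Each diagonal entry t of the Gram matrix satisfies t^2 >= 2 t - 1, and these
   entries add up to d^2. *)
Lemma gram_norm_ge u :
  \sum_x gram u x x = d%:R ^+ 2 -> d%:R ^+ 2 <= gram_norm u.
Proof.
move=> tr; apply: (@le_trans _ _ (\sum_x (2 * gram u x x - 1))).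
  rewrite sumrB -mulr_sumr tr sumr_const card_prod card_ord mulnn natrX.
  by rewrite (_ : 2 * _ - _ = d%:R ^+ 2) //; ring.
apply: ler_sum => x _; rewrite (bigD1 x) //=.
have gR : (gram u x x)^* = gram u x x.
  by rewrite rmorph_sum; apply: eq_bigr => z _; rewrite rmorphM /= conjCK mulrC.
set S := \sum_(i | _) _; have S0 : 0 <= S.
  by apply: sumr_ge0 => *; exact: mul_conjC_ge0.
have -> : gram u x x * (gram u x x)^* + S =
    2 * gram u x x - 1 + ((gram u x x - 1) * (gram u x x - 1)^* + S).
  by rewrite rmorphB /= gR rmorph1; ring.
by rewrite lerDl addr_ge0 // mul_conjC_ge0.
Qed.

Lemma gram_norm1 u :
  (forall x y, gram u x y = (x == y)%:R) -> gram_norm u = d%:R ^+ 2.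
Proof.
move=> gu; transitivity (\sum_(x : J) (1 : C)).
  apply: eq_bigr => x _; rewrite (bigD1 x) //= gu eqxx conjC_nat -natrM big1.
    by rewrite addr0.
  by move=> y yx; rewrite gu eq_sym (negPf yx) mul0r.
by rewrite sumr_const card_prod card_ord mulnn natrX.
Qed.

Lemma trace_gram u : (forall x y, gram u x y = (x == y)%:R) ->
  \sum_x gram u x x = d%:R ^+ 2.
Proof.
move=> gu; under eq_bigr do rewrite gu eqxx.
by rewrite sumr_const card_prod card_ord mulnn natrX.
Qed.

(** The trace is the sum of the squared moduli of all entries, which no regrouping of indices
    changes. *)
Lemma trace_gram_realign u :
  \sum_x gram (realign u) x x = \sum_x gram u x x.
Proof.
rewrite /gram !pair_bigA /=.
rewrite (reindex (fun t : J * J => ((t.1.1, t.2.2), (t.1.2, t.2.1)))) /=.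
  by apply: eq_bigr => [[[a b] [m n]]] _.
by exists (fun t : J * J => ((t.1.1, t.2.1), (t.2.2, t.1.2))) =>
  [[[? ?] [? ?]] _|[[? ?] [? ?]] _].
Qed.

Lemma trace_gram_partial_transpose u :
  \sum_x gram (partial_transpose u) x x = \sum_x gram u x x.
Proof.
rewrite /gram !pair_bigA /=.
rewrite (reindex (fun t : J * J => ((t.1.1, t.2.1), (t.1.2, t.2.2)))) /=.
  by apply: eq_bigr => [[[a b] [m n]]] _.
by exists (fun t : J * J => ((t.1.1, t.2.1), (t.1.2, t.2.2))) =>
  [[[? ?] [? ?]] _|[[? ?] [? ?]] _].
Qed.

End Purity.

Local Open Scope classical_set_scope.

(** * Integration over isometries *)

Section Measurability.
Context {R : realType}.
Local Notation C := R[i].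

Lemma normc_ge_Im (z : C) : `|complex.Im z|%:C <= `|z|.
Proof.
have := normc_ge_Re (z * 'i%C); rewrite ReiNIm normrN normrM.
suff -> : `|'i%C : C| = 1 by rewrite mulr1.
by rewrite normc_def /= expr0n expr1n add0r sqrtr1.
Qed.

Lemma continuous_measurable_borel_mx (m n : nat) (f : 'M[C^o]_(m, n) -> R) :
  continuous f -> measurable_fun (setT : set (borel_mx R m n)) f.
Proof.
move=> /continuousP cf; apply: (measurability _ (RGenOpens.measurableE R)).
move=> _ [_ [a [b ->] <-]]; rewrite setTI.
by apply: sub_sigma_algebra; apply: cf; exact: interval_open.
Qed.

Lemma continuous_Re : continuous (@complex.Re R : C^o -> R).
Proof.
move=> z A /nbhs_ballP[e /= e0 eA]; apply/nbhs_ballP; exists e%:C => /=.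
  by rewrite ltcR.
move=> w; rewrite /ball /= => wz; apply: eA; rewrite /ball /=.
by rewrite -raddfB -ltcR (le_lt_trans (normc_ge_Re _)).
Qed.

Lemma continuous_Im : continuous (@complex.Im R : C^o -> R).
Proof.
move=> z A /nbhs_ballP[e /= e0 eA]; apply/nbhs_ballP; exists e%:C => /=.
  by rewrite ltcR.
move=> w; rewrite /ball /= => wz; apply: eA; rewrite /ball /= -raddfB /=.
by rewrite -ltcR (le_lt_trans (normc_ge_Im _)).
Qed.

Lemma measurable_Re_coord (m n : nat) i j :
  measurable_fun setT (fun X : borel_mx R m n => complex.Re (X i j)).
Proof.
apply: continuous_measurable_borel_mx => X; apply: continuous_comp.
  exact: coord_continuous.
exact: continuous_Re.
Qed.

Lemma measurable_Im_coord (m n : nat) i j :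
  measurable_fun setT (fun X : borel_mx R m n => complex.Im (X i j)).
Proof.
apply: continuous_measurable_borel_mx => X; apply: continuous_comp.
  exact: coord_continuous.
exact: continuous_Im.
Qed.

Lemma continuous_mulmx (m n : nat) (V : 'M[C]_m) :
  continuous (fun X : 'M[C^o]_(m, n) => (V *m X : 'M[C^o]_(m, n))).
Proof.
move=> X A /nbhs_ballP[e /= e0 eA]; apply/nbhs_ballP.
(* The summand 1 makes M positive and strictly larger than every row sum, as the strict inequality
   at the end requires. *)
pose M : C := 1 + \sum_i \sum_k `|V i k|.
have M0 : 0 < M.
  by rewrite ltr_wpDr // sumr_ge0 // => i _; rewrite sumr_ge0.
exists (e / M) => /=; first by rewrite divr_gt0.
move=> Y [_ XY]; apply: eA; split=> // i j; rewrite /ball /= !mxE -sumrB.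
under eq_bigr do rewrite -mulrBr.
apply: (@le_lt_trans _ _ (\sum_k `|V i k| * (e / M))).
  apply: le_trans (ler_norm_sum _ _ _) _; apply: ler_sum => k _.
  rewrite normrM; apply: ler_wpM2l => //; apply: ltW; exact: XY.
rewrite -mulr_suml mulrA ltr_pdivrMr // mulrC ltr_pM2l //.
rewrite /M [X in _ < 1 + X](bigD1 i) //= ltr_pwDl // lerDl sumr_ge0 // => k _.
exact: sumr_ge0.
Qed.

Lemma measurable_mulmx (m n : nat) (V : 'M[C]_m) :
  measurable_fun setT (fun X : borel_mx R m n => (V *m X : borel_mx R m n)).
Proof.
apply: (@measurability _ _ (borel_mx R m n) (borel_mx R m n) setT _
  (@open 'M[C^o]_(m, n))) => //.
move=> _ [A oA <-]; rewrite setTI; apply: sub_sigma_algebra.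
by have /continuousP := @continuous_mulmx m n V; exact.
Qed.

End Measurability.

Section ComplexMeasurability.
Context {R : realType} {d : measure_display} {T : measurableType d}.
Local Notation C := R[i].

Definition cmeasurable (f : T -> C) :=
  measurable_fun setT (fun x => complex.Re (f x)) /\
  measurable_fun setT (fun x => complex.Im (f x)).

Lemma cmeasurable_cst (c : C) : cmeasurable (fun=> c).
Proof. by split; exact: measurable_cst. Qed.

Lemma cmeasurableD f g :
  cmeasurable f -> cmeasurable g -> cmeasurable (fun x => f x + g x).
Proof.
move=> [fr fi] [gr gi]; split.
  apply: eq_measurable_fun (measurable_funD fr gr) => x _ /=.
  by rewrite raddfD.
apply: eq_measurable_fun (measurable_funD fi gi) => x _ /=.
by rewrite raddfD.
Qed.

Lemma Re_mulc (x y : C) :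
  complex.Re (x * y) = complex.Re x * complex.Re y - complex.Im x * complex.Im y.
Proof. by case: x y => a b [c e]. Qed.

Lemma Im_mulc (x y : C) :
  complex.Im (x * y) = complex.Re x * complex.Im y + complex.Im x * complex.Re y.
Proof. by case: x y => a b [c e]. Qed.

Lemma cmeasurableM f g :
  cmeasurable f -> cmeasurable g -> cmeasurable (fun x => f x * g x).
Proof.
move=> [fr fi] [gr gi]; split.
  apply: eq_measurable_fun (measurable_funB
    (measurable_funM fr gr)
    (measurable_funM fi gi)) => x _ /=.
  by rewrite Re_mulc.
apply: eq_measurable_fun (measurable_funD
    (measurable_funM fr gi)
    (measurable_funM fi gr)) => x _ /=.
by rewrite Im_mulc.
Qed.

Lemma cmeasurable_conj f : cmeasurable f -> cmeasurable (fun x => (f x)^*).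
Proof.
move=> [fr fi]; split.
  by apply: eq_measurable_fun fr => x _ /=; case: (f x).
apply: eq_measurable_fun (measurable_funN fi) => x _ /=.
by case: (f x).
Qed.

Lemma cmeasurable_sum (I : Type) (r : seq I) (f : I -> T -> C) :
  (forall i, cmeasurable (f i)) -> cmeasurable (fun x => \sum_(i <- r) f i x).
Proof.
move=> fM; elim: r => [|i r IH].
  by under eq_fun do rewrite big_nil; exact: cmeasurable_cst.
by under eq_fun do rewrite big_cons; exact: cmeasurableD.
Qed.

Lemma measurable_zeros f : cmeasurable f -> measurable [set x | f x = 0].
Proof.
move=> [fr fi].
have -> : [set x | f x = 0] = ((fun x => complex.Re (f x)) @^-1` [set 0]) `&`
    ((fun x => complex.Im (f x)) @^-1` [set 0]).
  apply/seteqP; split=> x /= => [->//|[]].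
  by case: (f x) => a b /= -> ->.
apply: measurableI; rewrite -[X in measurable X]setTI.
  exact: fr.
exact: fi.
Qed.

End ComplexMeasurability.

Section Isometries.
Context {R : realType} {d n : nat}.
Local Notation C := R[i].

(** One domain for both integrals: the unit sphere for n = 1 and the unitary group for n = d. *)
Definition isometries : set (borel_mx R d n) :=
  [set X : 'M[C]_(d, n) | X^t* *m X = 1%:M].

Lemma cmeasurable_coord i j : cmeasurable (fun X : borel_mx R d n => X i j).
Proof. by split; [exact: measurable_Re_coord|exact: measurable_Im_coord]. Qed.

Lemma isometriesP (X : 'M[C]_(d, n)) : isometries X <->
  forall i j, \sum_k X k j * (X k i)^* = (i == j)%:R.
Proof.
have E i j : (X^t* *m X) i j = \sum_k X k j * (X k i)^*.
  by rewrite mxE; apply: eq_bigr => k _; rewrite !mxE mulrC.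
split=> [XX i j|H]; first by rewrite -E XX mxE.
by apply/matrixP => i j; rewrite E H mxE.
Qed.

Lemma measurable_isometries : measurable isometries.
Proof.
have -> : isometries = \bigcap_(p in [set: 'I_n * 'I_n]) [set X : borel_mx R d n |
    \sum_k X k p.2 * (X k p.1)^* + - (p.1 == p.2)%:R = 0].
  apply/seteqP; split=> X.
    by move=> /isometriesP H [i j] _ /=; rewrite H subrr.
  move=> H; apply/isometriesP => i j; apply/eqP; rewrite -subr_eq0; apply/eqP.
  exact: (H (i, j)).
apply: fin_bigcap_measurable => [|p _]; first exact: finite_finset.
apply: measurable_zeros; apply: cmeasurableD; last exact: cmeasurable_cst.
apply: cmeasurable_sum => k; apply: cmeasurableM; first exact: cmeasurable_coord.
by apply: cmeasurable_conj; exact: cmeasurable_coord.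
Qed.

Lemma isometries_mul (V : 'M[C]_d) (X : 'M[C]_(d, n)) :
  V \is unitarymx -> isometries (V *m X) <-> isometries X.
Proof.
move=> Vu; rewrite /isometries /= trmx_mul map_mxM mulmxA mulmxKtV //.
Qed.

Lemma isometries_le1 (X : 'M[C]_(d, n)) i j : isometries X -> `|X i j| <= 1.
Proof.
move=> /isometriesP /(_ j j) XX.
have {}XX : \sum_k X k j * (X k j)^* = 1 by rewrite XX eqxx.
rewrite -(@expr_le1 _ 2) // normCK -[leRHS]XX (bigD1 i) //= lerDl sumr_ge0 // => k _.
exact: mul_conjC_ge0.
Qed.

End Isometries.

Section ComplexIntegral.
Context {R : realType} {d n : nat} (mu : probability (borel_mx R d n) R).
Hypothesis mu1 : mu isometries = 1%E.
Hypothesis mu_inv : forall (V : 'M[R[i]]_d) (A : set (borel_mx R d n)),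
  V \is unitarymx -> measurable A ->
  mu [set X : 'M[R[i]]_(d, n) | A (V *m X)] = mu A.
Local Notation C := R[i].
Local Notation T := (borel_mx R d n).

(** Boundedness on the isometries, rather than mere integrability, makes the class stable under
    products; it contains every polynomial in the entries and their conjugates. *)
Definition cintegrable (f : T -> C) :=
  cmeasurable f /\ exists B : R, forall X, isometries X -> `|f X| <= B%:C.

Definition cint (f : T -> C) : C :=
  (\int[mu]_(X in isometries) complex.Re (f X)) +i*
  (\int[mu]_(X in isometries) complex.Im (f X)).

Lemma cintegrable_cst c : cintegrable (fun=> c).
Proof.
split; first exact: cmeasurable_cst.
by exists (complex.Re `|c|) => X _; rewrite RRe_real // normr_real.
Qed.

Lemma cintegrableD f g :
  cintegrable f -> cintegrable g -> cintegrable (fun X => f X + g X).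
Proof.
move=> [fm [B fB]] [gm [B' gB]]; split; first exact: cmeasurableD.
exists (B + B') => X DX; rewrite rmorphD.
by rewrite (le_trans (ler_normD _ _)) // lerD ?fB ?gB.
Qed.

Lemma cintegrableM f g :
  cintegrable f -> cintegrable g -> cintegrable (fun X => f X * g X).
Proof.
move=> [fm [B fB]] [gm [B' gB]]; split; first exact: cmeasurableM.
exists (B * B') => X DX; rewrite rmorphM normrM.
by rewrite ler_pM ?fB ?gB.
Qed.

Lemma cintegrable_conj f : cintegrable f -> cintegrable (fun X => (f X)^*).
Proof.
move=> [fm [B fB]]; split; first exact: cmeasurable_conj.
by exists B => X DX; rewrite norm_conjC fB.
Qed.

Lemma cintegrable_coord i j : cintegrable (fun X => X i j).
Proof.
split; first exact: cmeasurable_coord.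
by exists 1 => X DX; exact: isometries_le1.
Qed.

Lemma cintegrable_sum (I : Type) (r : seq I) (f : I -> T -> C) :
  (forall i, cintegrable (f i)) -> cintegrable (fun X => \sum_(i <- r) f i X).
Proof.
move=> fI; elim: r => [|i r IH].
  by under eq_fun do rewrite big_nil; exact: cintegrable_cst.
by under eq_fun do rewrite big_cons; exact: cintegrableD.
Qed.

Lemma integrable_Re f : cintegrable f ->
  mu.-integrable isometries (EFin \o (fun X => complex.Re (f X))).
Proof.
move=> [[fm _] [B fB]]; apply: measurable_bounded_integrable.
- exact: measurable_isometries.
- by rewrite [X in (X < _)%E]mu1 ltry.
- by apply: measurable_funS fm.
exists B; split; first exact: num_real.
move=> M BM X DX /=; rewrite -lecR (le_trans (normc_ge_Re _)) //.
by rewrite (le_trans (fB _ DX)) // lecR ltW.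
Qed.

Lemma integrable_Im f : cintegrable f ->
  mu.-integrable isometries (EFin \o (fun X => complex.Im (f X))).
Proof.
move=> [[_ fm] [B fB]]; apply: measurable_bounded_integrable.
- exact: measurable_isometries.
- by rewrite [X in (X < _)%E]mu1 ltry.
- by apply: measurable_funS fm.
exists B; split; first exact: num_real.
move=> M BM X DX /=; rewrite -lecR (le_trans (normc_ge_Im _)) //.
by rewrite (le_trans (fB _ DX)) // lecR ltW.
Qed.

Lemma eq_cint f g : (forall X, isometries X -> f X = g X) -> cint f = cint g.
Proof.
move=> fg; congr (_ +i* _); apply: eq_Rintegral => X /set_mem DX;
  by rewrite fg.
Qed.

Lemma cint_cst c : cint (fun=> c) = c.
Proof.
rewrite /cint !Rintegral_cst; [|exact: measurable_isometries..].
have e1 : fine (mu isometries) = 1 by rewrite mu1.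
by rewrite [fine _]e1 !mulr1; case: c.
Qed.

Lemma cintD f g : cintegrable f -> cintegrable g ->
  cint (fun X => f X + g X) = cint f + cint g.
Proof.
move=> fI gI; rewrite /cint; apply/eqP; rewrite eq_complex /=.
rewrite -!RintegralD; try exact: measurable_isometries;
  try exact: integrable_Re; try exact: integrable_Im.
by apply/andP; split; apply/eqP; apply: eq_Rintegral => X _; rewrite raddfD.
Qed.

Lemma cintZ c f : cintegrable f -> cint (fun X => c * f X) = c * cint f.
Proof.
move=> fI; have mD := @measurable_isometries R d n.
have Ir := integrable_Re _ fI; have Ii := integrable_Im _ fI.
have IZ (g : T -> R) (k : R) : mu.-integrable isometries (EFin \o g) ->
    mu.-integrable isometries (EFin \o (fun X => k * g X)).
  by move=> gI; exact: (integrableZl mD k gI).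
case: c => a b; rewrite /cint.
set I1 := Rintegral _ _ (fun X => complex.Re (f X)).
set I2 := Rintegral _ _ (fun X => complex.Im (f X)).
transitivity ((a * I1 - b * I2) +i* (a * I2 + b * I1)); last by [].
rewrite /I1 /I2 -!RintegralZl // -RintegralB ?IZ // -RintegralD ?IZ //.
by congr (_ +i* _); apply: eq_Rintegral => X _; case: (f X).
Qed.

Lemma cint_sum (I : Type) (r : seq I) (f : I -> T -> C) :
  (forall i, cintegrable (f i)) ->
  cint (fun X => \sum_(i <- r) f i X) = \sum_(i <- r) cint (f i).
Proof.
move=> fI; elim: r => [|i r IH].
  by under eq_fun do rewrite big_nil; rewrite cint_cst big_nil.
under eq_fun do rewrite big_cons.
by rewrite cintD ?IH ?big_cons //; exact: cintegrable_sum.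
Qed.

(** Left multiplication by V maps the isometries onto themselves and pushes mu forward to mu. *)
Lemma Rintegral_invariant (V : 'M[C]_d) (f : T -> R) : V \is unitarymx ->
  measurable_fun setT f ->
  mu.-integrable isometries (EFin \o (fun X : 'M[C]_(d, n) => f (V *m X))) ->
  \int[mu]_(X in isometries) f (V *m (X : 'M[C]_(d, n))) =
  \int[mu]_(X in isometries) f X.
Proof.
move=> Vu fm fI; congr fine; pose phi (X : T) : T := V *m (X : 'M[C]_(d, n)).
have DE : phi @^-1` isometries = isometries.
  by apply/seteqP; split => X /(isometries_mul V X Vu).
have mphi := measurable_mulmx d n V.
have mD := @measurable_isometries R d n.
transitivity (\int[pushforward mu phi]_(X in isometries) (f X)%:E)%E.
  rewrite integral_pushforward ?DE //.
  exact/measurable_EFinP.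
by apply: eq_measure_integral => A mA _; exact: mu_inv.
Qed.

Lemma cintegrable_mulmx (V : 'M[C]_d) f : V \is unitarymx ->
  cintegrable f -> cintegrable (fun X => f (V *m (X : 'M[C]_(d, n)))).
Proof.
move=> Vu [[fr fi] [B fB]]; split; last first.
  by exists B => X DX; apply: fB; exact/isometries_mul.
by split; [exact: (measurableT_comp fr (measurable_mulmx d n V))|
  exact: (measurableT_comp fi (measurable_mulmx d n V))].
Qed.

Lemma cint_invariant (V : 'M[C]_d) f : V \is unitarymx -> cintegrable f ->
  cint (fun X => f (V *m (X : 'M[C]_(d, n)))) = cint f.
Proof.
move=> Vu fI; have VI := cintegrable_mulmx V f Vu fI; congr (_ +i* _).
  exact: (Rintegral_invariant V (fun X => complex.Re (f X)) Vu fI.1.1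
    (integrable_Re _ VI)).
exact: (Rintegral_invariant V (fun X => complex.Im (f X)) Vu fI.1.2
    (integrable_Im _ VI)).
Qed.

End ComplexIntegral.

(** * Average entropy *)

Section Moments.
Context {R : realType} {d n : nat} (mu : probability (borel_mx R d n) R).
Hypothesis mu1 : mu isometries = 1%E.
Hypothesis mu_inv : forall (V : 'M[R[i]]_d) (A : set (borel_mx R d n)),
  V \is unitarymx -> measurable A ->
  mu [set X : 'M[R[i]]_(d, n) | A (V *m X)] = mu A.
Hypothesis d1 : (1 < d)%N.
Local Notation C := R[i].
Local Notation T := (borel_mx R d n).
Local Notation I4 := ('I_n * 'I_n * 'I_n * 'I_n)%type.

Definition coord4 (i : I4) (m1 m2 m3 m4 : 'I_d) (X : T) : C :=
  X m1 i.1.1.1 * X m2 i.1.1.2 * (X m3 i.1.2)^* * (X m4 i.2)^*.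

Lemma cintegrable_coord4 i m1 m2 m3 m4 : cintegrable (coord4 i m1 m2 m3 m4).
Proof.
have cI := @cintegrable_coord R d n.
apply: cintegrableM; last exact/cintegrable_conj/cI.
apply: cintegrableM; last exact/cintegrable_conj/cI.
exact: cintegrableM.
Qed.

Lemma cint_tensor_act (V : 'M[C]_d) (F : 'I_d -> 'I_d -> 'I_d -> 'I_d -> T -> C)
    m1 m2 m3 m4 : (forall k1 k2 k3 k4, cintegrable (F k1 k2 k3 k4)) ->
  cint mu (fun X => tensor_act V (fun k1 k2 k3 k4 => F k1 k2 k3 k4 X) m1 m2 m3 m4)
  = tensor_act V (fun k1 k2 k3 k4 => cint mu (F k1 k2 k3 k4)) m1 m2 m3 m4.
Proof.
move=> FI.
have ZI c f : cintegrable f -> cintegrable (fun X : T => c * f X).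
  by apply: cintegrableM; exact: cintegrable_cst.
rewrite /tensor_act cint_sum // => [|k1]; last first.
  apply/ZI/cintegrable_sum => k2; apply/ZI/cintegrable_sum => k3.
  by apply/ZI/cintegrable_sum => k4; exact: ZI.
apply: eq_bigr => k1 _; rewrite cintZ //; last first.
  apply: cintegrable_sum => k2; apply/ZI/cintegrable_sum => k3.
  by apply/ZI/cintegrable_sum => k4; exact: ZI.
congr (_ * _); rewrite cint_sum // => [|k2]; last first.
  by apply/ZI/cintegrable_sum => k3; apply/ZI/cintegrable_sum => k4; exact: ZI.
apply: eq_bigr => k2 _; rewrite cintZ //; last first.
  by apply: cintegrable_sum => k3; apply/ZI/cintegrable_sum => k4; exact: ZI.
congr (_ * _); rewrite cint_sum // => [|k3]; last first.
  by apply/ZI/cintegrable_sum => k4; exact: ZI.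
apply: eq_bigr => k3 _; rewrite cintZ //; last first.
  by apply/cintegrable_sum => k4; exact: ZI.
congr (_ * _); rewrite cint_sum // => [|k4]; last exact: ZI.
by apply: eq_bigr => k4 _; rewrite cintZ.
Qed.

Lemma coord4_mulmx (V : 'M[C]_d) i m1 m2 m3 m4 (X : T) :
  coord4 i m1 m2 m3 m4 (V *m (X : 'M[C]_(d, n))) =
  tensor_act V (fun k1 k2 k3 k4 => coord4 i k1 k2 k3 k4 X) m1 m2 m3 m4.
Proof.
have S (c f : 'I_d -> C) a : \sum_k c k * (a * f k) = a * \sum_k c k * f k.
  by rewrite mulr_sumr; apply: eq_bigr => k _; rewrite mulrCA.
have E m j : (V *m (X : 'M[C]_(d, n))) m j = \sum_k V m k * X k j by rewrite mxE.
have Ec m j : ((V *m (X : 'M[C]_(d, n))) m j)^* = \sum_k (V m k)^* * (X k j)^*.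
  by rewrite E rmorph_sum; apply: eq_bigr => k _; rewrite rmorphM.
rewrite /coord4 /tensor_act !Ec !E; apply/esym.
transitivity (\sum_k1 V m1 k1 * (\sum_k2 V m2 k2 * (\sum_k3 (V m3 k3)^* *
    (X k1 i.1.1.1 * X k2 i.1.1.2 * (\sum_k (V m4 k)^* * (X k i.2)^*)
       * (X k3 i.1.2)^*)))).
  apply: eq_bigr => k1 _; congr (_ * _); apply: eq_bigr => k2 _; congr (_ * _).
  by apply: eq_bigr => k3 _; congr (_ * _); rewrite S mulrAC.
set s4 := \sum_k _ * (X k i.2)^*; set s3 := \sum_k _ * (X k i.1.2)^*.
transitivity (\sum_k1 V m1 k1 * (\sum_k2 V m2 k2 *
    (X k1 i.1.1.1 * s4 * s3 * X k2 i.1.1.2))).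
  apply: eq_bigr => k1 _; congr (_ * _); apply: eq_bigr => k2 _; congr (_ * _).
  by rewrite S -/s3; ring.
set s2 := \sum_k _ * X k i.1.1.2.
transitivity (\sum_k1 V m1 k1 * (s4 * s3 * s2 * X k1 i.1.1.1)).
  by apply: eq_bigr => k1 _; congr (_ * _); rewrite S -/s2; ring.
by rewrite S; ring.
Qed.

(** Left invariance of mu makes the moments, as a tensor in the row indices, invariant under
    [tensor_act]. The two contractions needed by [invariant_tensorE] are integrals of constants, by
    orthonormality of the columns of X. *)
Lemma cint_coord4 (i : I4) m1 m2 m3 m4 :
  let D : C := d%:R * (d%:R ^+ 2 - 1) in
  let t1 : C := ((i.1.1.1 == i.1.2) && (i.1.1.2 == i.2))%:R in
  let t2 : C := ((i.1.1.1 == i.2) && (i.1.1.2 == i.1.2))%:R in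
  cint mu (coord4 i m1 m2 m3 m4) =
    (d%:R * t1 - t2) / D * ((m1 == m3) && (m2 == m4))%:R +
    (d%:R * t2 - t1) / D * ((m1 == m4) && (m2 == m3))%:R.
Proof.
move=> D t1 t2.
rewrite (@invariant_tensorE _ _ (fun m1 m2 m3 m4 => cint mu (coord4 i m1 m2 m3 m4)));
  [|move=> V Vu k1 k2 k3 k4|by []]; last first.
  rewrite -cint_tensor_act; last by move=> *; exact: cintegrable_coord4.
  rewrite -[RHS](cint_invariant _ mu1 mu_inv V _ Vu (cintegrable_coord4 _ _ _ _ _)).
  by congr cint; apply/funext => X; rewrite coord4_mulmx.
have sum2 (f g : 'I_d -> C) :
    \sum_m1 \sum_m2 (f m1 * g m2) = (\sum_m f m) * (\sum_m g m).
  by rewrite mulr_suml; apply: eq_bigr => k _; rewrite mulr_sumr.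
have -> : \sum_m1 \sum_m2 cint mu (coord4 i m1 m2 m1 m2) = t1.
  transitivity (cint mu (fun X => \sum_m1 \sum_m2 coord4 i m1 m2 m1 m2 X)).
    rewrite cint_sum // => [|k]; last first.
      by apply: cintegrable_sum => ?; exact: cintegrable_coord4.
    apply: eq_bigr => k _; rewrite cint_sum // => *; exact: cintegrable_coord4.
  rewrite -[RHS](cint_cst mu mu1); apply: eq_cint => X /isometriesP XX.
  transitivity ((\sum_m X m i.1.1.1 * (X m i.1.2)^*) *
    (\sum_m X m i.1.1.2 * (X m i.2)^*)).
    rewrite -sum2; apply: eq_bigr => k1 _; apply: eq_bigr => k2 _.
    by rewrite /coord4; ring.
  by rewrite !XX -natrM mulnb ![i.1.2 == _]eq_sym [i.2 == _]eq_sym.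
have -> : \sum_m1 \sum_m2 cint mu (coord4 i m1 m2 m2 m1) = t2.
  transitivity (cint mu (fun X => \sum_m1 \sum_m2 coord4 i m1 m2 m2 m1 X)).
    rewrite cint_sum // => [|k]; last first.
      by apply: cintegrable_sum => ?; exact: cintegrable_coord4.
    apply: eq_bigr => k _; rewrite cint_sum // => *; exact: cintegrable_coord4.
  rewrite -[RHS](cint_cst mu mu1); apply: eq_cint => X /isometriesP XX.
  transitivity ((\sum_m X m i.1.1.1 * (X m i.2)^*) *
    (\sum_m X m i.1.1.2 * (X m i.1.2)^*)).
    rewrite -sum2; apply: eq_bigr => k1 _; apply: eq_bigr => k2 _.
    by rewrite /coord4; ring.
  by rewrite !XX -natrM mulnb ![i.1.2 == _]eq_sym ![i.2 == _]eq_sym.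
by [].
Qed.


(** In each summand X and Y are separated, so the inner integral only replaces [g t Y] by a constant
    and the outer one acts on a linear combination of the [f t]. *)
Lemma double_int (I : finType) (c0 : C) (c : I -> C) (f g : I -> T -> C) :
  (forall t, cintegrable (f t)) -> (forall t, cintegrable (g t)) ->
  \int[mu]_(X in isometries) \int[mu]_(Y in isometries)
    complex.Re (c0 + \sum_t c t * (f t X * g t Y)) =
  complex.Re (c0 + \sum_t c t * (cint mu (f t) * cint mu (g t))).
Proof.
move=> fI gI.
have ZI k h : cintegrable h -> cintegrable (fun X : T => k * h X).
  by apply: cintegrableM; exact: cintegrable_cst.
have cS k (h : I -> T -> C) : (forall t, cintegrable (h t)) ->
    cint mu (fun X => c0 + \sum_t k t * h t X) = c0 + \sum_t k t * cint mu (h t).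
  move=> hI; rewrite cintD ?cint_cst //; first last.
  - by apply: cintegrable_sum => t; exact: ZI.
  - exact: cintegrable_cst.
  congr (_ + _); rewrite cint_sum // => [|t]; last exact: ZI.
  by apply: eq_bigr => t _; rewrite cintZ.
transitivity (\int[mu]_(X in isometries) complex.Re
    (c0 + \sum_t (c t * cint mu (g t)) * f t X)).
  apply: eq_Rintegral => X _.
  rewrite -[LHS]/(complex.Re (cint mu (fun Y => c0 + \sum_t c t * (f t X * g t Y)))).
  congr complex.Re; rewrite -[RHS]/(c0 + _).
  transitivity (c0 + \sum_t (c t * f t X) * cint mu (g t)).
    rewrite -cS //; congr cint; apply/funext => Y; congr (_ + _).
    by apply: eq_bigr => t _; rewrite mulrA.
  by congr (_ + _); apply: eq_bigr => t _; rewrite mulrAC.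
rewrite -[LHS]/(complex.Re (cint mu (fun X =>
  c0 + \sum_t (c t * cint mu (g t)) * f t X))).
rewrite cS //; congr (complex.Re (_ + _)).
by apply: eq_bigr => t _; rewrite -mulrA [cint _ (g t) * _]mulrC.
Qed.

End Moments.

Section Entropy.
Context {R : realType} {d : nat}.
Local Notation C := R[i].
Local Notation J := ('I_d * 'I_d)%type.

Definition on_pairs (U : 'M[C]_(d * d)) (x y : J) : C :=
  U (mxtens_index x) (mxtens_index y).

Lemma sum_mxtens_index (f : 'I_(d * d) -> C) :
  \sum_k f k = \sum_x f (mxtens_index x).
Proof.
rewrite (reindex (@mxtens_index d d)) //.
by exists (@mxtens_unindex d d) => x _; rewrite ?mxtens_indexK ?mxtens_unindexK.
Qed.

Lemma gram_on_pairs (U : 'M[C]_(d * d)) : U \is unitarymx ->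
  forall x y, gram (on_pairs U) x y = (x == y)%:R.
Proof.
move=> /unitarymxP/matrixP UU x y.
have := UU (mxtens_index x) (mxtens_index y); rewrite !mxE.
rewrite (can_eq (@mxtens_indexK d d)) => <-.
by rewrite sum_mxtens_index; apply: eq_bigr => z _; rewrite !mxE.
Qed.

Lemma linear_entropyE (psi : 'cV[C]_(d * d)) :
  linear_entropy psi = d%:R / (d%:R - 1) *
    (1 - complex.Re (purity (fun x => psi (mxtens_index x) 0))).
Proof.
rewrite /linear_entropy /=; congr (_ * (1 - complex.Re _)).
have rhoE a a' : partial_traceB (ket_bra psi) a a' =
    \sum_b psi (mxtens_index (a, b)) 0 * (psi (mxtens_index (a', b)) 0)^*.
  by rewrite mxE; apply: eq_bigr => b _; rewrite !mxE big_ord1 !mxE.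
rewrite /purity /mxtrace.
under eq_bigr do rewrite mxE.
under eq_bigr do under eq_bigr do rewrite !rhoE big_distrlr /= pair_bigA /=.
rewrite !pair_bigA /=.
rewrite (reindex (fun t : J * J => ((t.1.1, t.2.1), (t.1.2, t.2.2)))) /=.
  by apply: eq_bigr => [[[a b] [a' b']]] _ /=; ring.
by exists (fun t : J * J => ((t.1.1, t.2.1), (t.1.2, t.2.2))) =>
  [[[? ?] [? ?]] _|[[? ?] [? ?]] _].
Qed.

End Entropy.

Section AverageEntropy.
Context {R : realType} {d n : nat} (mu : probability (borel_mx R d n) R).
Hypothesis mu1 : mu isometries = 1%E.
Hypothesis mu_inv : forall (V : 'M[R[i]]_d) (A : set (borel_mx R d n)),
  V \is unitarymx -> measurable A ->
  mu [set X : 'M[R[i]]_(d, n) | A (V *m X)] = mu A.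
Hypothesis d1 : (1 < d)%N.
Local Notation C := R[i].
Local Notation T := (borel_mx R d n).
Local Notation J := ('I_d * 'I_d)%type.
Local Notation I4 := ('I_n * 'I_n * 'I_n * 'I_n)%type.

(** The quantity G(U); both summands are sums of squared moduli, so taking the real part loses
    nothing. *)
Definition entangling_gram (U : 'M[C]_(d * d)) : R :=
  complex.Re (gram_norm (realign (on_pairs U)) +
              gram_norm (partial_transpose (on_pairs U))).

Lemma tensor2_sum (k : C) (X Y : T) (w : J * J * J * J) : k^* = k ->
  tensor2 (fun x => k * \sum_i X x.1 i * Y x.2 i) w =
  k ^+ 4 * \sum_(i : I4)
    coord4 i w.1.1.1.1 w.1.1.2.1 w.1.2.1 w.2.1 X *
    coord4 i w.1.1.1.2 w.1.1.2.2 w.1.2.2 w.2.2 Y.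
Proof.
move=> kR; rewrite /tensor2 !rmorphM /= kR !rmorph_sum /=.
set f1 := fun i => X w.1.1.1.1 i * Y w.1.1.1.2 i.
set f2 := fun i => X w.1.1.2.1 i * Y w.1.1.2.2 i.
set f3 := fun i => (X w.1.2.1 i * Y w.1.2.2 i)^*.
set f4 := fun i => (X w.2.1 i * Y w.2.2 i)^*.
transitivity (k ^+ 4 * ((\sum_i f1 i) * (\sum_i f2 i) * (\sum_i f3 i) * (\sum_i f4 i))).
  by ring.
rewrite mul4_sum; congr (_ * _); apply: eq_bigr => i _.
by rewrite /f1 /f2 /f3 /f4 /coord4 !rmorphM /=; ring.
Qed.

(** Multiplying the two moment formulas gives terms in t1^2 = t1, t2^2 = t2 and t1 t2, whose sums
    over the column indices are n^2, n^2 and n. The normalization turns k^4 n^2 into 1 and k^4 n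
    into k^2. *)
Lemma sum_cint_coord4 (k : C) (w : J * J * J * J) : k ^+ 2 * n%:R = 1 ->
  let D : C := d%:R * (d%:R ^+ 2 - 1) in
  k ^+ 4 * \sum_(i : I4)
    cint mu (coord4 i w.1.1.1.1 w.1.1.2.1 w.1.2.1 w.2.1) *
    cint mu (coord4 i w.1.1.1.2 w.1.1.2.2 w.1.2.2 w.2.2) =
  purity_moment ((d%:R ^+ 2 + 1 - 2 * d%:R * k ^+ 2) / D ^+ 2)
    (((d%:R ^+ 2 + 1) * k ^+ 2 - 2 * d%:R) / D ^+ 2) w.
Proof.
move=> kn D; case: w => [[[[m1 n1] [m2 n2]] [m3 n3]] [m4 n4]] /=.
under eq_bigr do rewrite !(cint_coord4 mu mu1 mu_inv d1) -/D.
pose t1 (i : I4) : C := ((i.1.1.1 == i.1.2) && (i.1.1.2 == i.2))%:R.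
pose t2 (i : I4) : C := ((i.1.1.1 == i.2) && (i.1.1.2 == i.1.2))%:R.
set dm1 : C := ((m1 == m3) && _)%:R; set dm2 : C := ((m1 == m4) && _)%:R.
set dn1 : C := ((n1 == n3) && _)%:R; set dn2 : C := ((n1 == n4) && _)%:R.
have nest (F : I4 -> C) :
    \sum_i F i = \sum_i1 \sum_i2 \sum_i3 \sum_i4 F (i1, i2, i3, i4).
  by rewrite !pair_bigA; apply: eq_bigr => -[[[? ?] ?] ?].
have sum1 (c : C) : \sum_(i < n) c = n%:R * c.
  by rewrite sumr_const card_ord mulr_natl.
have s1 : \sum_i t1 i = n%:R ^+ 2.
  rewrite nest -[RHS]mulr1 expr2 -mulrA -!sum1.
  apply: eq_bigr => i1 _; apply: eq_bigr => i2 _.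
  rewrite -[RHS](sum_delta i1 (fun=> 1)); apply: eq_bigr => i3 _.
  rewrite -[X in _ = _ * X](sum_delta i2 (fun=> 1)) mulr_sumr; apply: eq_bigr => i4 _.
  by rewrite /t1 mulr1 -natrM mulnb.
have s2 : \sum_i t2 i = n%:R ^+ 2.
  rewrite nest -[RHS]mulr1 expr2 -mulrA -!sum1.
  apply: eq_bigr => i1 _; apply: eq_bigr => i2 _.
  rewrite -[RHS](sum_delta i2 (fun=> 1)); apply: eq_bigr => i3 _.
  rewrite -[X in _ = _ * X](sum_delta i1 (fun=> 1)) mulr_sumr; apply: eq_bigr => i4 _.
  by rewrite /t2 mulr1 -natrM mulnb andbC.
have s12 : \sum_i t1 i * t2 i = n%:R.
  rewrite nest -[RHS]mulr1 -sum1; apply: eq_bigr => i1 _.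
  rewrite -[RHS](sum_delta i1 (fun=> 1)); apply: eq_bigr => i2 _.
  transitivity (\sum_i3 (i1 == i3)%:R * \sum_i4 (i2 == i4)%:R *
      ((i1 == i4)%:R * (i2 == i3)%:R) : C).
    apply: eq_bigr => i3 _; rewrite mulr_sumr; apply: eq_bigr => i4 _.
    by rewrite /t1 /t2 -!natrM !mulnb !andbA.
  rewrite (sum_delta i1) (sum_delta i2) mulr1 -natrM mulnb.
  by rewrite [i2 == i1]eq_sym andbb.
have idem (b : bool) : b%:R * b%:R = b%:R :> C by rewrite -natrM mulnb andbb.
transitivity (k ^+ 4 * (
    (d%:R ^+ 2 * dm1 * dn1 + dm2 * dn2 - d%:R * (dm1 * dn2 + dm2 * dn1))
      / D ^+ 2 * (\sum_i t1 i)
  + (d%:R ^+ 2 * dm2 * dn2 + dm1 * dn1 - d%:R * (dm1 * dn2 + dm2 * dn1))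
      / D ^+ 2 * (\sum_i t2 i)
  + ((d%:R ^+ 2 + 1) * (dm1 * dn2 + dm2 * dn1)
      - 2 * d%:R * (dm1 * dn1 + dm2 * dn2))
      / D ^+ 2 * (\sum_i t1 i * t2 i))).
  congr (_ * _); rewrite !mulr_sumr -!big_split /=; apply: eq_bigr => i _.
  rewrite -/(t1 i) -/(t2 i).
  have h1 : t1 i * t1 i = t1 i by exact: idem.
  have h2 : t2 i * t2 i = t2 i by exact: idem.
  transitivity ((d%:R ^+ 2 * dm1 * dn1 + dm2 * dn2 - d%:R * (dm1 * dn2 + dm2 * dn1))
      / D ^+ 2 * (t1 i * t1 i)
    + (d%:R ^+ 2 * dm2 * dn2 + dm1 * dn1 - d%:R * (dm1 * dn2 + dm2 * dn1))
      / D ^+ 2 * (t2 i * t2 i)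
    + ((d%:R ^+ 2 + 1) * (dm1 * dn2 + dm2 * dn1) - 2 * d%:R * (dm1 * dn1 + dm2 * dn2))
      / D ^+ 2 * (t1 i * t2 i)); last by rewrite h1 h2.
  by rewrite -!exprVn; move: D^-1 => v; ring.
rewrite s1 s2 s12.
have k4n2 : k ^+ 4 * n%:R ^+ 2 = 1 by rewrite (exprM k 2 2) -exprMn kn expr1n.
have k4n : k ^+ 4 * n%:R = k ^+ 2 by rewrite (exprM k 2 2) expr2 -mulrA kn mulr1.
have -> : ((((m3, n3) == (m1, n1)) && ((m4, n4) == (m2, n2)))%:R : C) = dm1 * dn1.
  by rewrite !xpair_eqE /dm1 /dn1 -natrM mulnb ![m3 == _]eq_sym ![m4 == _]eq_sym
    ![n3 == _]eq_sym ![n4 == _]eq_sym andbACA.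
have -> : ((((m3, n3) == (m2, n2)) && ((m4, n4) == (m1, n1)))%:R : C) = dm2 * dn2.
  rewrite !xpair_eqE /dm2 /dn2 -natrM mulnb ![m3 == _]eq_sym ![m4 == _]eq_sym
    ![n3 == _]eq_sym ![n4 == _]eq_sym andbACA.
  by rewrite [(m2 == m3) && _]andbC [(n2 == n3) && _]andbC.
have -> : ((((m3, n3) == (m1, n2)) && ((m4, n4) == (m2, n1)))%:R : C) = dm1 * dn2.
  rewrite !xpair_eqE /dm1 /dn2 -natrM mulnb ![m3 == _]eq_sym ![m4 == _]eq_sym
    ![n3 == _]eq_sym ![n4 == _]eq_sym andbACA.
  by rewrite [(n2 == n3) && _]andbC.
have -> : ((((m3, n3) == (m2, n1)) && ((m4, n4) == (m1, n2)))%:R : C) = dm2 * dn1.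
  rewrite !xpair_eqE /dm2 /dn1 -natrM mulnb ![m3 == _]eq_sym ![m4 == _]eq_sym
    ![n3 == _]eq_sym ![n4 == _]eq_sym andbACA.
  by rewrite [(m2 == m3) && _]andbC.
have -> A B E : k ^+ 4 * (A * n%:R ^+ 2 + B * n%:R ^+ 2 + E * n%:R) = A + B + E * k ^+ 2.
  transitivity (A * (k ^+ 4 * n%:R ^+ 2) + B * (k ^+ 4 * n%:R ^+ 2)
    + E * (k ^+ 4 * n%:R)); first by ring.
  by rewrite k4n2 k4n !mulr1.
by rewrite -!exprVn; move: D^-1 => v; ring.
Qed.

(* For n = 1, k = 1 the vectors phi X Y are the product states; for n = d,
   k = 1 / sqrt d they are (X (x) Y)|psi_+>. *)
Lemma average_entropy (U : 'M[C]_(d * d)) (k : R)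
    (phi : 'M[C]_(d, n) -> 'M[C]_(d, n) -> 'cV[C]_(d * d)) :
  U \is unitarymx -> k ^+ 2 * n%:R = 1 ->
  (forall X Y x, phi X Y (mxtens_index x) 0 = k%:C * \sum_i X x.1 i * Y x.2 i) ->
  let D : R := d%:R * (d%:R ^+ 2 - 1) in
  \int[mu]_(X in isometries) \int[mu]_(Y in isometries)
    linear_entropy (U *m phi X Y) =
  d%:R / (d%:R - 1) * (1 -
    ((d%:R ^+ 2 + 1 - 2 * d%:R * k ^+ 2) / D ^+ 2 * (2 * d%:R ^+ 3)
     + ((d%:R ^+ 2 + 1) * k ^+ 2 - 2 * d%:R) / D ^+ 2 * entangling_gram U)).
Proof.
move=> Uu kn phiE D; pose c : R := d%:R / (d%:R - 1).
pose K := purity_kernel (on_pairs U).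
pose a : R := (d%:R ^+ 2 + 1 - 2 * d%:R * k ^+ 2) / D ^+ 2.
pose b : R := ((d%:R ^+ 2 + 1) * k ^+ 2 - 2 * d%:R) / D ^+ 2.
have knC : k%:C ^+ 2 * n%:R = 1 :> C.
  by rewrite -rmorphXn /= -[n%:R](rmorph_nat (real_complex R)) -rmorphM kn.
have kC : (k%:C)^* = k%:C by exact: conjc_real.
(* An index t joins the four pair indices of the purity kernel to the four column indices of X and
   Y; the entropy becomes a linear combination of products of the form required by [double_int]. *)
pose f (t : (J * J * J * J) * I4) :=
  coord4 (R := R) t.2 t.1.1.1.1.1 t.1.1.1.2.1 t.1.1.2.1 t.1.2.1.
pose g (t : (J * J * J * J) * I4) :=
  coord4 (R := R) t.2 t.1.1.1.1.2 t.1.1.1.2.2 t.1.1.2.2 t.1.2.2.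
pose w (t : (J * J * J * J) * I4) : C := - (c%:C * K t.1 * k%:C ^+ 4).
have flat (F : (J * J * J * J) -> I4 -> C) :
    \sum_t w t * F t.1 t.2 = - (c%:C * \sum_x K x * (k%:C ^+ 4 * \sum_i F x i)).
  rewrite -(pair_bigA _ (fun x i => - (c%:C * K x * k%:C ^+ 4) * F x i)) /=.
  rewrite mulr_sumr -sumrN; apply: eq_bigr => x _; rewrite -mulr_sumr; ring.
have ReZ (r : R) (z : C) : complex.Re (r%:C * z) = r * complex.Re z.
  by case: z => x y /=; rewrite mul0r subr0.
transitivity (\int[mu]_(X in isometries) \int[mu]_(Y in isometries)
    complex.Re (c%:C + \sum_t w t * (f t X * g t Y))).
  apply: eq_Rintegral => X _; apply: eq_Rintegral => Y _.
  rewrite linear_entropyE -/c.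
  transitivity (complex.Re (c%:C * (1 - \sum_x K x * tensor2
      (fun x => k%:C * \sum_i (X : 'M[C]_(d,n)) x.1 i * (Y : 'M[C]_(d,n)) x.2 i) x))).
    rewrite -purity_apply ReZ raddfB; congr (_ * (_ - complex.Re (purity _))).
    apply/funext => x; rewrite mxE sum_mxtens_index.
    by apply: eq_bigr => p _; rewrite phiE.
  congr complex.Re; rewrite (flat (fun x i => f (x, i) X * g (x, i) Y)).
  rewrite mulrBr mulr1; congr (_ - _ * _); apply: eq_bigr => x _.
  by rewrite (tensor2_sum _ _ _ _ kC).
rewrite (double_int mu mu1); [|by move=> t; exact: cintegrable_coord4..].
rewrite (flat (fun x i => cint mu (f (x, i)) * cint mu (g (x, i)))).
have -> : \sum_x K x * (k%:C ^+ 4 * \sum_i cint mu (f (x, i)) * cint mu (g (x, i))) =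
   \sum_x K x * purity_moment a%:C b%:C x.
  apply: eq_bigr => x _; congr (_ * _); rewrite sum_cint_coord4 //.
  by rewrite /a /b /D !(fmorph_div, rmorphXn, rmorphM, rmorphB, rmorphD,
    rmorph1, rmorph_nat) /=.
rewrite sum_purity_moment; last exact: gram_on_pairs.
rewrite -/c -/a -/b -[X in X - _]mulr1 -mulrBr ReZ raddfB raddfD /= ReZ.
rewrite (_ : 2 * d%:R ^+ 3 = (2 * d%:R ^+ 3 : R)%:C) ?ReZ //.
by rewrite !(rmorphXn, rmorphM, rmorph_nat).
Qed.

End AverageEntropy.

(** * Existence of a minimum *)

Section ComplexContinuity.
Context {R : realType} {T : topologicalType}.
Local Notation C := R[i].

Definition ccontinuous (f : T -> C) :=
  continuous (fun x => complex.Re (f x)) /\ continuous (fun x => complex.Im (f x)).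

Lemma ccontinuous_cst c : ccontinuous (fun=> c).
Proof. by split=> x; exact: cvg_cst. Qed.

Lemma ccontinuousD f g :
  ccontinuous f -> ccontinuous g -> ccontinuous (fun x => f x + g x).
Proof.
move=> [fr fi] [gr gi]; split=> x; under eq_fun do rewrite raddfD.
  exact: (cvgD (fr x) (gr x)).
exact: (cvgD (fi x) (gi x)).
Qed.

Lemma ccontinuousM f g :
  ccontinuous f -> ccontinuous g -> ccontinuous (fun x => f x * g x).
Proof.
move=> [fr fi] [gr gi]; split=> x.
  under eq_fun do rewrite Re_mulc.
  exact: (cvgB (cvgM (fr x) (gr x)) (cvgM (fi x) (gi x))).
under eq_fun do rewrite Im_mulc.
exact: (cvgD (cvgM (fr x) (gi x)) (cvgM (fi x) (gr x))).
Qed.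

Lemma ccontinuous_conj f : ccontinuous f -> ccontinuous (fun x => (f x)^*).
Proof.
move=> [fr fi]; split=> x.
  have -> : (fun x => complex.Re (f x)^*) = (fun x => complex.Re (f x)).
    by apply/funext => y; case: (f y).
  exact: fr.
have -> : (fun x => complex.Im (f x)^*) = (fun x => - complex.Im (f x)).
  by apply/funext => y; case: (f y).
exact: (cvgN (fi x)).
Qed.

Lemma ccontinuous_sum (I : Type) (r : seq I) (f : I -> T -> C) :
  (forall i, ccontinuous (f i)) -> ccontinuous (fun x => \sum_(i <- r) f i x).
Proof.
move=> fM; elim: r => [|i r IH].
  by under eq_fun do rewrite big_nil; exact: ccontinuous_cst.
by under eq_fun do rewrite big_cons; exact: ccontinuousD.
Qed.

Lemma closed_zeros f : ccontinuous f -> closed [set x | f x = 0].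
Proof.
move=> [fr fi].
have -> : [set x | f x = 0] = ((fun x => complex.Re (f x)) @^-1` [set 0]) `&`
    ((fun x => complex.Im (f x)) @^-1` [set 0]).
  apply/seteqP; split=> x /= => [->//|[]].
  by case: (f x) => a b /= -> ->.
by apply: closedI; apply: preimage_closed => //; exact: closed1.
Qed.

End ComplexContinuity.

Section Minimum.
Context {R : realType} {d : nat}.
Local Notation C := R[i].
Local Notation N := (d * d)%N.

(** Matrices are coded by the real ([true]) and imaginary ([false]) parts of their entries, so that
    compactness comes from a product of segments. *)
Let T : topologicalType :=
  prod_topology (fun _ : 'I_N * 'I_N * bool => (R : topologicalType)).

Definition mx_of_coords (f : T) : 'M[C]_N :=
  \matrix_(i, j) (f (i, j, true) +i* f (i, j, false)).

Lemma ccontinuous_entry i j : ccontinuous (fun f : T => mx_of_coords f i j).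
Proof.
split=> f; under eq_fun do rewrite mxE /=.
  exact: (@proj_continuous _ (fun _ => R : topologicalType) (i, j, true) f).
exact: (@proj_continuous _ (fun _ => R : topologicalType) (i, j, false) f).
Qed.

Lemma ccontinuous_gram_norm (u : T -> 'I_d * 'I_d -> 'I_d * 'I_d -> C) :
  (forall x y, ccontinuous (fun f => u f x y)) ->
  ccontinuous (fun f => gram_norm (u f)).
Proof.
move=> uc; rewrite /gram_norm /gram.
have gc x y : ccontinuous (fun f => \sum_z u f x z * (u f y z)^*).
  by apply: ccontinuous_sum => z; apply: ccontinuousM => //; exact: ccontinuous_conj.
apply: ccontinuous_sum => x; apply: ccontinuous_sum => y.
by apply: ccontinuousM => //; exact: ccontinuous_conj.
Qed.

(** The unitary matrices form a closed set cut out by polynomial equations; their rows are unit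
    vectors, so all coordinates lie in [-1, 1] and the set is compact. G is polynomial in the
    coordinates, hence attains its minimum. *)
Lemma exists_min_entangling_gram : exists2 U : 'M[C]_N, U \is unitarymx &
  forall V : 'M[C]_N, V \is unitarymx -> entangling_gram U <= entangling_gram V.
Proof.
pose A : set T := [set f | mx_of_coords f \is unitarymx].
pose coords (U : 'M[C]_N) : T := fun t =>
  if t.2 then complex.Re (U t.1.1 t.1.2) else complex.Im (U t.1.1 t.1.2).
have coordsK U : mx_of_coords (coords U) = U.
  by apply/matrixP => i j; rewrite mxE /coords /=; case: (U i j).
have A0 : A !=set0.
  exists (coords 1%:M); rewrite /A /= coordsK; apply/unitarymxP.
  by rewrite mul1mx trmx1 map_mx1.
have cA : closed A.
  have -> : A = \bigcap_(p in [set: 'I_N * 'I_N]) [set f |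
      \sum_k mx_of_coords f p.1 k * (mx_of_coords f p.2 k)^* + - (p.1 == p.2)%:R = 0].
    apply/seteqP; split=> f.
      move=> /unitarymxP/matrixP fu [i j] _ /=.
      have := fu i j; rewrite mxE [X in _ = X]mxE => <-.
      by apply/eqP; rewrite subr_eq0; apply/eqP; apply: eq_bigr => k _; rewrite !mxE.
    move=> H; apply/unitarymxP/matrixP => i j; rewrite [RHS]mxE; apply/eqP.
    rewrite -subr_eq0 -(H (i, j) I) /=; apply/eqP; congr (_ - _).
    by rewrite mxE; apply: eq_bigr => k _; rewrite !mxE.
  apply: closed_bigI => p _; apply: closed_zeros.
  apply: ccontinuousD; last exact: ccontinuous_cst.
  apply: ccontinuous_sum => k; apply: ccontinuousM; first exact: ccontinuous_entry.
  by apply: ccontinuous_conj; exact: ccontinuous_entry.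
have kA : compact A.
  have kB := @tychonoff _ (fun _ : 'I_N * 'I_N * bool => (R : topologicalType))
    (fun _ => `[(-1 : R), 1]%classic) (fun _ => @segment_compact R (-1) 1).
  apply: (subclosed_compact cA kB) => f /unitarymxP/matrixP fu [[i j] b].
  have f1 : `|mx_of_coords f i j| <= 1.
    have {}fu : \sum_k mx_of_coords f i k * (mx_of_coords f i k)^* = 1.
      have := fu i i; rewrite mxE [X in _ = X]mxE eqxx => fi; rewrite -[RHS]fi.
      by apply: eq_bigr => k _; rewrite !mxE.
    rewrite -(@expr_le1 _ 2) // normCK -[leRHS]fu (bigD1 j) //= lerDl sumr_ge0 // => k _.
    exact: mul_conjC_ge0.
  rewrite /= in_itv /= -ler_norml -(lecR (R := R)).
  apply: le_trans f1; rewrite mxE; case: b.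
    exact: (normc_ge_Re (Complex _ _)).
  exact: (normc_ge_Im (Complex _ _)).
have cG : continuous (fun f => entangling_gram (mx_of_coords f)).
  apply: (ccontinuousD _ _ _ _).1; apply: ccontinuous_gram_norm => x y;
    exact: ccontinuous_entry.
have [c cA' cmin] := @compact_EVT_min T R _ A A0 kA (continuous_subspaceT cG).
exists (mx_of_coords c); first exact: set_mem cA'.
move=> V Vu; rewrite -(coordsK V); apply: cmin; apply/mem_set.
by rewrite /A /= coordsK.
Qed.

End Minimum.

(** * Extremal permutations *)

Section Extremal.
Context {R : realType} {d : nat}.
Local Notation C := R[i].
Local Notation J := ('I_d * 'I_d)%type.

Lemma natrX_double : d%:R ^+ 2 + d%:R ^+ 2 = (2 * d%:R ^+ 2 : R)%:C :> C.
Proof. by rewrite !(rmorphXn, rmorphM, rmorph_nat) /=; ring. Qed.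

Lemma entangling_gram_ge (U : 'M[C]_(d * d)) : U \is unitarymx ->
  2 * d%:R ^+ 2 <= entangling_gram U.
Proof.
move=> /gram_on_pairs /trace_gram tr.
have h1 : d%:R ^+ 2 <= gram_norm (realign (on_pairs U)).
  by apply: gram_norm_ge; rewrite trace_gram_realign.
have h2 : d%:R ^+ 2 <= gram_norm (partial_transpose (on_pairs U)).
  by apply: gram_norm_ge; rewrite trace_gram_partial_transpose.
by have := lerD h1 h2; rewrite natrX_double lecE => /andP[_].
Qed.

Lemma gram_graph (h : J -> J) (u : J -> J -> C) : injective h ->
  (forall x y, u x y = (h x == y)%:R) -> forall x y, gram u x y = (x == y)%:R.
Proof.
move=> h_inj uh x y; rewrite /gram (bigD1 (h x)) //= !uh eqxx conjC_nat.
rewrite mul1r (inj_eq h_inj) eq_sym big1 ?addr0 // => z zx.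
by rewrite uh eq_sym (negPf zx) mul0r.
Qed.

(** The permutation sends columns (0, 1) of each array row to columns (2, 3). Its realignment then
    matches columns (0, 3) with (1, 2), and its partial transpose (0, 2) with (1, 3). As any two
    columns determine the row, these are permutations too, and both Gram matrices are the
    identity. *)
Lemma exists_perm_entangling_gram : has_oa 4 d ->
  exists s : 'S_(d * d), @entangling_gram R d (perm_mx s) = 2 * d%:R ^+ 2.
Proof.
move=> [B [c [cB cP]]].
pose o (k : nat) : 'I_4 := inord k.
pose p i j b := (c (o i) b, c (o j) b).
have onE i j : (i < 4)%N -> (j < 4)%N -> i != j -> o i != o j.
  by move=> i4 j4; apply: contra => /eqP /(congr1 val); rewrite /= !inordK // => ->.
have p_inj i j : (i < 4)%N -> (j < 4)%N -> i != j -> injective (p i j).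
  by move=> i4 j4 ij b b' [e1 e2]; exact: cP (onE _ _ i4 j4 ij) e1 e2.
have p_bij i j : (i < 4)%N -> (j < 4)%N -> i != j -> bijective (p i j).
  move=> i4 j4 ij; apply: inj_card_bij; first exact: p_inj.
  by rewrite card_prod cB !card_ord.
have [q01 q01K p01K] := p_bij 0 1 isT isT isT.
have [q02 q02K p02K] := p_bij 0 2 isT isT isT.
have [q03 q03K p03K] := p_bij 0 3 isT isT isT.
pose h x := p 2 3 (q01 x).
have sinj : injective (fun k => mxtens_index (h (mxtens_unindex k)) : 'I_(d * d)).
  apply: (inj_comp (can_inj (@mxtens_indexK d d))).
  apply: (@inj_comp _ _ _ h _ _ (can_inj (@mxtens_unindexK d d))).
  exact: (inj_comp (p_inj 2 3 isT isT isT) (can_inj p01K)).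
exists (perm sinj).
have uE x y : on_pairs (perm_mx (perm sinj) : 'M[C]_(d * d)) x y = (h x == y)%:R.
  rewrite /on_pairs !mxE permE mxtens_indexK.
  by rewrite (can_eq (@mxtens_indexK d d)).
rewrite /entangling_gram.
rewrite (gram_norm1 (realign _)); last first.
  apply: (gram_graph (fun x => p 1 2 (q03 x))).
    exact: (inj_comp (p_inj 1 2 isT isT isT) (can_inj p03K)).
  move=> x [z1 z2]; rewrite /realign uE -{1 2}(p03K x) /h /=.
  congr (nat_of_bool _)%:R.
  set b := q03 x; apply/eqP/eqP => [H|[<- <-]]; last first.
    by rewrite -[(c (o 0) b, c (o 1) b)]/(p 0 1 b) q01K.
  (* The row b' through ([c (o 0) b], z1) agrees with b in columns 0 and 3, hence is b. *)
  have e01 := p01K (c (o 0) b, z1); move: H e01; move: (q01 _) => b' [e2 e3] [e0 e1].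
  have bb : b' = b by exact: (p_inj 0 3 isT isT isT _ _ (congr2 pair e0 e3)).
  by rewrite -e1 -e2 bb.
rewrite (gram_norm1 (partial_transpose _)); last first.
  apply: (gram_graph (fun x => p 1 3 (q02 x))).
    exact: (inj_comp (p_inj 1 3 isT isT isT) (can_inj p02K)).
  move=> x [z1 z2]; rewrite /partial_transpose uE -{1 2}(p02K x) /h /=.
  congr (nat_of_bool _)%:R.
  set b := q02 x; apply/eqP/eqP => [H|[<- <-]]; last first.
    by rewrite -[(c (o 0) b, c (o 1) b)]/(p 0 1 b) q01K.
  have e01 := p01K (c (o 0) b, z1); move: H e01; move: (q01 _) => b' [e2 e3] [e0 e1].
  have bb : b' = b by exact: (p_inj 0 2 isT isT isT _ _ (congr2 pair e0 e2)).
  by rewrite -e1 -e3 bb.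
by rewrite natrX_double.
Qed.

End Extremal.

(** * Both powers as affine functions of G *)

Section Powers.
Context {R : realType} {d : nat}.
Hypothesis d1 : (1 < d)%N.
Local Notation C := R[i].

Lemma unit_sphereE : @unit_sphere R d = isometries.
Proof.
apply/seteqP; split=> X; rewrite /unit_sphere /isometries /= => XX.
  by apply/matrixP => i j; rewrite !ord1 XX mxE eqxx.
by rewrite XX mxE eqxx.
Qed.

Lemma unitary_groupE : @unitary_group R d = isometries.
Proof.
apply/seteqP; split=> X; rewrite /unitary_group /isometries /=.
  by move=> /unitarymxP /mulmx1C.
by move=> /mulmx1C XX; apply/unitarymxP.
Qed.

Lemma d_neq0 : d%:R != 0 :> R.
Proof. by rewrite pnatr_eq0 -lt0n ltnW. Qed.

Lemma d_gt1 : 1 < d%:R :> R.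
Proof. by rewrite ltr1n. Qed.

(** For n = 1 and k = 1 both coefficients of [average_entropy] equal (d - 1)^2 / D^2 = 1 / (d (d +
    1))^2. *)
Lemma entangling_powerE (mu : probability (borel_mx R d 1) R) U :
  is_uniform_sphere mu -> U \is unitarymx ->
  entangling_power mu U = d%:R / (d%:R - 1) * (1 -
    (2 * d%:R ^+ 3 + entangling_gram U) / (d%:R * (d%:R + 1)) ^+ 2).
Proof.
move=> [mu1 mu_inv] Uu; have d11 := d_gt1.
rewrite unit_sphereE in mu1; rewrite /entangling_power unit_sphereE.
have k1 : (1 : R) ^+ 2 * 1%:R = 1 by rewrite expr1n mulr1.
rewrite (average_entropy mu mu1 mu_inv d1 U 1
  (fun X Y : 'M[C]_(d, 1) => (tensmx X Y : 'cV_(d * d))) Uu k1); last first.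
  move=> X Y [x y]; rewrite mul1r big_ord1 -tensmxE; congr (tensmx _ _ _ _).
  exact/val_inj.
congr (_ * (1 - _)); field.
by apply/andP; split; [|apply/andP; split]; apply/eqP; nra.
Qed.

(** For n = d and k^2 = 1/d the coefficients are (d^2 - 1) / D^2 and - (d^2 - 1) / (d D^2); the
    second is negative, so here the average purity decreases with G. *)
Lemma disentangling_powerE (nu : probability (borel_mx R d d) R) U :
  is_haar_unitary nu -> U \is unitarymx ->
  disentangling_power nu U = 1 - d%:R / (d%:R - 1) * (1 -
    (2 * d%:R ^+ 4 - entangling_gram U) / (d%:R ^+ 3 * (d%:R ^+ 2 - 1))).
Proof.
move=> [nu1 nu_inv] Uu; have d11 := d_gt1; have d0 := d_neq0.
rewrite unitary_groupE in nu1; rewrite /disentangling_power unitary_groupE.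
pose k : R := (Num.sqrt d%:R)^-1.
have k1 : k ^+ 2 * d%:R = 1 by rewrite exprVn sqr_sqrtr // mulVf.
under eq_Rintegral do under eq_Rintegral do rewrite -mulmxA.
rewrite (average_entropy nu nu1 nu_inv d1 U k
  (fun X Y : 'M[C]_(d, d) => tensmx X Y *m psi_plus R d) Uu k1); last first.
  move=> X Y [x y]; rewrite mxE sum_mxtens_index /=.
  have psiE z : psi_plus R d (mxtens_index z) 0 = k%:C * (z.1 == z.2)%:R.
    rewrite !mxE summxE; congr (_ * _).
    under eq_bigr do rewrite mxE andbT (can_eq (@mxtens_indexK d d)).
    case: z => z1 z2; rewrite (bigD1 z1) //= xpair_eqE eqxx /= eq_sym.
    rewrite big1 ?addr0 // => i iz.
    by rewrite xpair_eqE eq_sym (negPf iz).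
  transitivity (\sum_i \sum_j tensmx X Y (mxtens_index (x, y)) (mxtens_index (i, j)) *
      (k%:C * (i == j)%:R)).
    by rewrite pair_bigA; apply: eq_bigr => -[i j] _; rewrite psiE.
  rewrite mulr_sumr.
  apply: eq_bigr => i _; rewrite (bigD1 i) //= eqxx big1 ?addr0 => [|j ji].
    by rewrite tensmxE mulr1 mulrC.
  by rewrite eq_sym (negPf ji) !mulr0.
have -> : k ^+ 2 = d%:R^-1 by rewrite -[LHS](mulfK d0) k1 mul1r.
congr (1 - _ * (1 - _)); field.
by rewrite d0 andbT gt_eqF ?subr_gt0 ?exprn_egt1.
Qed.

End Powers.

Lemma eq_maximizes {T : Type} {R : realType} {D : set T} {f g : T -> R} {x : T} :
  (forall y z, D y -> D z -> (f y <= f z) = (g y <= g z)) ->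
  maximizes D f x <-> maximizes D g x.
Proof.
move=> fg; split=> -[Dx xmax]; split=> // y Dy.
  by rewrite -fg //; exact: xmax.
by rewrite fg //; exact: xmax.
Qed.

(** The first clause keeps the second from being vacuous. The role of permutation matrices is read
    as: they suffice to attain the maximum. *)
Theorem theorem3 (R : realType) (d : nat) (hd : (2 <= d)%N)
    (mu : probability (borel_mx R d 1) R) (hmu : is_uniform_sphere mu)
    (nu : probability (borel_mx R d d) R) (hnu : is_haar_unitary nu) :
  [/\ (exists U : 'M[R[i]]_(d * d),
         maximizes (@unitary_group R (d * d)) (entangling_power mu) U),
      (forall U : 'M[R[i]]_(d * d),
         maximizes (@unitary_group R (d * d)) (entangling_power mu) U ->
         maximizes (@unitary_group R (d * d)) (disentangling_power nu) U) &
      (d <> 2%N -> d <> 6%N ->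
         (forall U : 'M[R[i]]_(d * d),
            maximizes (@unitary_group R (d * d)) (disentangling_power nu) U ->
            disentangling_power nu U = 1 / (d%:R - 1)) /\
         exists P : 'M[R[i]]_(d * d), is_perm_mx P /\
           maximizes (@unitary_group R (d * d)) (disentangling_power nu) P)].
Proof.
have d11 : 1 < d%:R :> R := d_gt1 hd.
have c0 : 0 < d%:R / (d%:R - 1) :> R by rewrite divr_gt0 ?subr_gt0 // (lt_trans ltr01).
have a0 : 0 < ((d%:R * (d%:R + 1)) ^+ 2)^-1 :> R by rewrite invr_gt0; nra.
have b0 : 0 < (d%:R ^+ 3 * (d%:R ^+ 2 - 1))^-1 :> R.
  by rewrite invr_gt0 mulr_gt0 ?exprn_gt0 ?subr_gt0 ?exprn_egt1 // (lt_trans ltr01).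
(* Each power is a decreasing function of G, so its maximizers are those of -G. *)
have entP U : maximizes (@unitary_group R (d * d)) (entangling_power mu) U <->
    maximizes (@unitary_group R (d * d)) (fun V => - entangling_gram V) U.
  apply: eq_maximizes => V W Vu Wu.
  rewrite (entangling_powerE hd _ _ hmu Vu) (entangling_powerE hd _ _ hmu Wu).
  move: (entangling_gram V) (entangling_gram W) => x y.
  by rewrite (ler_pM2l c0) lerD2l !lerN2 (ler_pM2r a0) lerD2l.
have disP U : maximizes (@unitary_group R (d * d)) (disentangling_power nu) U <->
    maximizes (@unitary_group R (d * d)) (fun V => - entangling_gram V) U.
  apply: eq_maximizes => V W Vu Wu.
  rewrite (disentangling_powerE hd _ _ hnu Vu) (disentangling_powerE hd _ _ hnu Wu).
  move: (entangling_gram V) (entangling_gram W) => x y.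
  by rewrite lerD2l lerN2 (ler_pM2l c0) lerD2l lerN2 (ler_pM2r b0) lerD2l.
split.
- have [U Uu Umin] := @exists_min_entangling_gram R d.
  by exists U; apply/entP; split=> // V Vu; rewrite lerN2 Umin.
- by move=> U /entP/disP.
move=> d2 d6.
have [s sE] : exists s : 'S_(d * d), @entangling_gram R d (perm_mx s) = 2 * d%:R ^+ 2.
  apply/exists_perm_entangling_gram/bose_shrikhande_parker; last exact/eqP.
  by rewrite ltn_neqAle hd eq_sym andbT; apply/eqP.
have su : (perm_mx s : 'M[R[i]]_(d * d)) \is unitarymx by exact: perm_unitary.
have smax : maximizes (@unitary_group R (d * d)) (disentangling_power nu) (perm_mx s).
  by apply/disP; split=> // V Vu; rewrite lerN2 sE; exact: entangling_gram_ge.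
split; last by exists (perm_mx s); split=> //; apply/is_perm_mxP; exists s.
move=> U [Uu Umax].
(* All maximizers share one value, which can be computed at the permutation. *)
have -> : disentangling_power nu U = disentangling_power nu (perm_mx s).
  by apply: le_anti; apply/andP; split; [exact: smax.2 _ Uu|exact: Umax _ su].
(* At G = 2 d^2 the average purity is 2/d, and 1 - d / (d - 1) * (1 - 2/d) = 1 / (d - 1). *)
rewrite (disentangling_powerE hd _ _ hnu su) sE; field.
by apply/andP; split; [|apply/andP; split]; apply/eqP; nra.
Qed.
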